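(* A generalized F-structure $E$ on $M$ is equivalent with an endomorphism $\Phi:T^{big}M\rightarrow T^{big}M$ (a real vector bundle endomorphism over the identity) that satisfies the two conditions $$\Phi^3+\Phi=0,\qquad g(\Phi\mathcal{X},\mathcal{Y})+g(\mathcal{X},\Phi\mathcal{Y})=0\quad\forall \mathcal{X},\mathcal{Y}\in T^{big}M .$$ The correspondence is the one for which $E$, its complex conjugate $\bar E$, and $S_c=E'\cap\bar E'$ are the eigenbundles of (the complexification of) $\Phi$ for the eigenvalues $\sqrt{-1}$, $-\sqrt{-1}$, $0$, respectively.
   Context: $M$ is an $m$-dimensional $C^\infty$ manifold. $T^{big}M=TM\oplus T^*M$ carries the neutral metric $g((X,\alpha),(Y,\beta))=\frac12(\alpha(Y)+\beta(X))$, extended complex bilinearly to $T^{big}_cM=T^{big}M\otimes\mathbb{C}$. For a complex subbundle $E\subseteq T^{big}_cM$, $E'=E^{\perp_g}$ denotes its $g$-orthogonal subbundle, and the bar denotes complex conjugation. A generalized F-structure is a complex subbundle $E\subseteq T^{big}_cM$ that is $g$-isotropic ($g|_E=0$, i.e. $E\subseteq E'$; such a subbundle is called a big-isotropic structure) and satisfies $E\cap\bar E'=0$, where $\bar E'$ is the complex conjugate of $E'$. *)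

(* Defs.v *)
From HB Require Import structures.
From mathcomp Require Import all_boot all_order all_algebra complex.
From mathcomp Require Import all_classical all_reals all_analysis.
Import Order.TTheory GRing.Theory Num.Theory numFieldNormedType.Exports.

Set Implicit Arguments.
Unset Strict Implicit.
Unset Printing Implicit Defensive.

Local Open Scope classical_set_scope.
Local Open Scope ring_scope.

Section Smooth.
Variables (R : realType) (V W : normedModType R).

(* C^k on U, meant for U open: f is C^(k+1) iff it is (Frechet) differentiable
   at every point of U and all its directional derivatives are C^k. *)
Fixpoint Ck (k : nat) (U : set V) (f : V -> W) : Prop :=
  if k is k'.+1 then
    (forall x, U x -> differentiable f x) /\
    (forall v, Ck k' U (fun x => 'D_v f x))
  else forall x, U x -> {for x, continuous f}.

Definition smooth_on (U : set V) (f : V -> W) : Prop := forall k, Ck k U f.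

Lemma near_eq_diff (f g : V -> W) (x v : V) :
  differentiable f x -> differentiable g x -> (\near x, f x = g x) ->
  'd f x v = 'd g x v.
Proof.
by move=> df dg fg; rewrite -(deriveE v df) -(deriveE v dg);
  exact: near_eq_derive.
Qed.

Lemma near_diff_comp (X : normedModType R) (f : V -> W) (g : W -> X)
    (h : V -> X) (x v : V) (y : W) :
  f x = y -> differentiable f x -> differentiable g y -> differentiable h x ->
  (\near x, g (f x) = h x) -> 'd g y ('d f x v) = 'd h x v.
Proof.
move=> <- df dg dh gfh; have dgf := differentiable_comp df dg.
have e := diff_comp df dg.
rewrite -[LHS]/(('d g (f x) \o 'd f x) v) -e.
by rewrite -(deriveE v dgf) -(deriveE v dh); exact: near_eq_derive.
Qed.

End Smooth.

(* A chart is a pair of total functions [chart i], [chart_inv i]; only the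
   values of the former on [chart_dom i] and of the latter on the image of
   [chart_dom i] are meaningful.  The atlas need not be maximal. *)
Record manifold (R : realType) (m : nat) := Manifold {
  carrier :> topologicalType;
  mfd_hausdorff : hausdorff_space carrier;
  mfd_second_countable : @second_countable carrier;
  chart_index : Type;
  chart_dom : chart_index -> set carrier;
  chart : chart_index -> carrier -> 'rV[R]_m;
  chart_inv : chart_index -> 'rV[R]_m -> carrier;
  chart_dom_open : forall i, open (chart_dom i);
  chart_cover : forall p, exists i, chart_dom i p;
  chart_img_open : forall i, open (chart i @` chart_dom i);
  chartK : forall i p, chart_dom i p -> chart_inv i (chart i p) = p;
  chart_continuous : forall i p, chart_dom i p ->
    {for p, continuous (chart i)};
  chart_inv_continuous : forall i y, (chart i @` chart_dom i) y ->
    {for y, continuous (chart_inv i)};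
  transition_smooth : forall i j,
    smooth_on (chart i @` (chart_dom i `&` chart_dom j))
              (chart j \o chart_inv i)
}.

Section Dual.
Variables (R : realType) (V : lmodType R).

Definition linear_form : {pred V -> R^o} :=
  fun f : V -> R^o => `[< linear f >].

Lemma linear_form_submod_closed : submod_closed linear_form.
Proof.
split=> [|a f g /asboolP lf /asboolP lg]; apply/asboolP => b u v.
  by rewrite scaler0 addr0.
by rewrite !fctE /= lf lg !scalerDr !scalerA mulrC addrACA.
Qed.

HB.instance Definition _ :=
  GRing.isSubmodClosed.Build R (V -> R^o) linear_form
    linear_form_submod_closed.

Record dual := Dual {
  dual_fun :> V -> R^o;
  dual_funP : dual_fun \in linear_form }.

HB.instance Definition _ := [isSub for dual_fun].
HB.instance Definition _ := [Choice of dual by <:].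
HB.instance Definition _ := [SubChoice_isSubLmodule of dual by <:].

End Dual.

Section Complexification.
Variables (R : realType) (V : lmodType R).

(* The pair (x, y) stands for x + i y in V (x) C. *)
Definition complexification : Type := (V * V)%type.

HB.instance Definition _ := GRing.Zmodule.on complexification.

Definition cscale (z : R[i]) (x : complexification) : complexification :=
  let: (a +i* b)%C := z in
  (a *: x.1 - b *: x.2, a *: x.2 + b *: x.1).

Lemma cscalerA a b v : cscale a (cscale b v) = cscale (a * b) v.
Proof.
case: a b v => [a1 a2] [b1 b2] [x y]; rewrite /cscale /=.
by congr pair; rewrite !scalerBr !scalerDr !scalerA !scalerBl !scalerDl;
  rewrite ?opprD (AC (2*2) ((1*4)*(2*3))).
Qed.

Lemma cscale1r : left_id 1 cscale.
Proof. by case=> x y; rewrite /cscale /= !scale1r !scale0r subr0 addr0. Qed.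

Lemma cscalerDr : right_distributive cscale +%R.
Proof.
case=> a b [x1 x2] [y1 y2]; rewrite /cscale /=.
by congr pair; rewrite /= !scalerDr ?opprD addrACA.
Qed.

Lemma cscalerDl v : {morph cscale^~ v : a b / a + b}.
Proof.
case: v => x y [a1 a2] [b1 b2]; rewrite /cscale /=.
by congr pair; rewrite /= !scalerDl ?opprD addrACA.
Qed.

HB.instance Definition _ := GRing.Zmodule_isLmodule.Build R[i] complexification
  cscalerA cscale1r cscalerDr cscalerDl.

Definition cconj (x : complexification) : complexification := (x.1, - x.2).

Definition complexify (f : V -> V) (x : complexification) : complexification :=
  (f x.1, f x.2).

(* complex bilinear extension of a real bilinear form *)
Definition cform (b : V -> V -> R) (x y : complexification) : R[i] :=
  ((b x.1 y.1 - b x.2 y.2) +i* (b x.1 y.2 + b x.2 y.1))%C.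

End Complexification.

Section Tangent.
Variables (R : realType) (m : nat) (M : manifold R m).
Implicit Types (i j : chart_index M) (p : M).

Definition transition i j : 'rV[R]_m -> 'rV[R]_m := chart j \o chart_inv i.

(* A tangent vector at p is a family of coordinate vectors, one for each chart
   at p, which transform by the differentials of the transition maps.  The
   components at the charts whose domain misses p are set to 0. *)
Definition tangent_family p : {pred chart_index M -> 'rV[R]_m} :=
  fun v : chart_index M -> 'rV[R]_m =>
  `[< (forall j, ~ chart_dom j p -> v j = 0) /\
      (forall i j, chart_dom i p -> chart_dom j p ->
         v j = 'd (transition i j) (chart i p) (v i)) >].

Lemma tangent_family_submod_closed p : submod_closed (tangent_family p).
Proof.
split=> [|a v w /asboolP[v0 vd] /asboolP[w0 wd]]; apply/asboolP; split.
- by [].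
- by move=> i j _ _; rewrite linear0.
- by move=> j pj; rewrite !fctE v0// w0// scaler0 addr0.
- by move=> i j pi pj; rewrite !fctE (vd i j)// (wd i j)// linearP.
Qed.

HB.instance Definition _ p :=
  GRing.isSubmodClosed.Build R (chart_index M -> 'rV[R]_m) (tangent_family p)
    (tangent_family_submod_closed p).

Record tangent p := Tangent {
  tangent_comp :> chart_index M -> 'rV[R]_m;
  tangent_compP : tangent_comp \in tangent_family p }.

HB.instance Definition _ p := [isSub for @tangent_comp p].
HB.instance Definition _ p := [Choice of tangent p by <:].
HB.instance Definition _ p := [SubChoice_isSubLmodule of tangent p by <:].

Definition cotangent p := dual (tangent p).
HB.instance Definition _ p := GRing.Lmodule.on (cotangent p).

Definition bigT p := (tangent p * cotangent p)%type.
HB.instance Definition _ p := GRing.Lmodule.on (bigT p).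

Definition bigTc p := complexification (bigT p).
HB.instance Definition _ p := GRing.Lmodule.on (bigTc p).

(* The tangent vector with components w in the chart i.  When p is in the
   domain of i the family is in [tangent_family p] (lemma [tvecE]); otherwise
   the value is irrelevant. *)
Definition tvec i p (w : 'rV[R]_m) : tangent p :=
  insubd 0 (fun j => if `[< chart_dom j p >]
                     then 'd (transition i j) (chart i p) w else 0).

Lemma transition_differentiable i j p : chart_dom i p -> chart_dom j p ->
  differentiable (transition i j) (chart i p).
Proof. by move=> pi pj; apply: (transition_smooth i j 1%N).1; exists p. Qed.

Lemma chart_dom_near i j p : chart_dom i p -> chart_dom j p ->
  \forall y \near chart i p, chart_dom j (chart_inv i y).
Proof.
move=> pi pj.
have ci : {for chart i p, continuous (chart_inv i)}.
  by apply: chart_inv_continuous; exists p.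
by apply: ci; rewrite chartK//; apply: open_nbhs_nbhs; split=> //;
  exact: chart_dom_open.
Qed.

Lemma transition_cocycle i j k p w :
  chart_dom i p -> chart_dom j p -> chart_dom k p ->
  'd (transition j k) (chart j p) ('d (transition i j) (chart i p) w) =
  'd (transition i k) (chart i p) w.
Proof.
move=> pi pj pk.
apply: near_diff_comp; first by rewrite /transition /= chartK.
- exact: transition_differentiable.
- exact: transition_differentiable.
- exact: transition_differentiable.
apply: filterS (chart_dom_near pi pj) => y yj.
by rewrite /transition /= chartK.
Qed.

Lemma transition_id i p w : chart_dom i p ->
  'd (transition i i) (chart i p) w = w.
Proof.
move=> pi.
have did : differentiable id (chart i p) by exact: ex_diff.
have e : 'd id (chart i p) w = w by rewrite -(deriveE w did) derive_id.
rewrite -[RHS]e; apply: near_eq_diff => //; first exact: transition_differentiable.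
have : nbhs (chart i p) (chart i @` chart_dom i).
  by apply: open_nbhs_nbhs; split; [exact: chart_img_open|exists p].
by apply: filterS => _ [q qi <-]; rewrite /transition /= chartK.
Qed.

Lemma tvecE i j p w : chart_dom i p -> chart_dom j p ->
  tvec i p w j = 'd (transition i j) (chart i p) w.
Proof.
move=> pi pj; rewrite /tvec /insubd insubT /=; last by rewrite asboolT.
apply/asboolP; split=> [k pk|k l pk pl]; first by rewrite asboolF.
rewrite (asboolT pk) (asboolT pl); exact: esym (transition_cocycle w pi pk pl).
Qed.

Lemma tvecK i p w : chart_dom i p -> tvec i p w i = w.
Proof. by move=> pi; rewrite tvecE// transition_id. Qed.

Lemma tangent_compK i p (X : tangent p) : chart_dom i p -> tvec i p (X i) = X.
Proof.
move=> pi; apply/val_inj/funext => j.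
have /asboolP[X0 Xd] := tangent_compP X.
have [pj|pj] := pselect (chart_dom j p); first by rewrite /= tvecE// -Xd.
have /asboolP[Y0 _] := tangent_compP (tvec i p (X i)).
by rewrite /= (X0 j pj) (Y0 j pj).
Qed.

Definition cotangent_comp i p (a : cotangent p) : 'rV[R]_m :=
  \row_k a (tvec i p (delta_mx 0 k)).

(* Sections over an open set U are restrictions of (possibly rough) sections
   over M. *)
Definition smooth_section (U : set M) (s : forall p, bigT p) : Prop :=
  forall i,
    smooth_on (chart i @` (U `&` chart_dom i))
      (fun y => (s (chart_inv i y)).1 i) /\
    smooth_on (chart i @` (U `&` chart_dom i))
      (fun y => cotangent_comp i (s (chart_inv i y)).2).

Definition smooth_csection (U : set M) (s : forall p, bigTc p) : Prop :=
  smooth_section U (fun p => (s p).1) /\ smooth_section U (fun p => (s p).2).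

Definition smooth_endo (Phi : forall p, bigT p -> bigT p) : Prop :=
  (forall p, linear (Phi p)) /\
  (forall (U : set M) s, open U -> smooth_section U s ->
     smooth_section U (fun p => Phi p (s p))).

(* The rank is locally constant, hence constant when M is connected. *)
Definition subbundle (E : forall p, set (bigTc p)) : Prop :=
  forall p, exists (U : set M) (k : nat) (s : 'I_k -> forall q, bigTc q),
    [/\ open U, U p, (forall a, smooth_csection U (s a)) &
        forall q, U q ->
          E q = [set x | exists c : 'I_k -> R[i],
                   x = \sum_(a < k) c a *: s a q] /\
          (forall c : 'I_k -> R[i],
             \sum_(a < k) c a *: s a q = 0 -> forall a, c a = 0)].

Definition metric p (x y : bigT p) : R := 2^-1 * (x.2 y.1 + y.2 x.1).

Definition orthogonal (E : forall p, set (bigTc p)) p : set (bigTc p) :=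
  [set x | forall y, E p y -> cform (@metric p) x y = 0].
Arguments orthogonal E p _ : clear implicits.

Definition conjugate (E : forall p, set (bigTc p)) p : set (bigTc p) :=
  @cconj R (bigT p) @` E p.
Arguments conjugate E p _ : clear implicits.

Definition eigenbundle (Phi : forall p, bigT p -> bigT p) (z : R[i])
    (F : forall p, set (bigTc p)) : Prop :=
  subbundle F /\ forall p, F p = [set x | complexify (Phi p) x = z *: x].

Definition generalized_F_structure (E : forall p, set (bigTc p)) : Prop :=
  [/\ subbundle E,
      forall p, E p `<=` orthogonal E p &
      forall p, E p `&` conjugate (orthogonal E) p = [set 0]].

Definition F_endomorphism (Phi : forall p, bigT p -> bigT p) : Prop :=
  [/\ smooth_endo Phi,
      forall p x, Phi p (Phi p (Phi p x)) + Phi p x = 0 &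
      forall p x y, metric (Phi p x) y + metric x (Phi p y) = 0].

Definition F_correspondence (E : forall p, set (bigTc p))
    (Phi : forall p, bigT p -> bigT p) : Prop :=
  [/\ eigenbundle Phi (0 +i* 1)%C E,
      eigenbundle Phi (- (0 +i* 1)%C) (conjugate E) &
      eigenbundle Phi 0
        (fun p => orthogonal E p `&` conjugate (orthogonal E) p)].

End Tangent.

Arguments orthogonal {R m M} E p _.
Arguments conjugate {R m M} E p _.

(* Main.v *)
Require Import Defs.
From HB Require Import structures.
From mathcomp Require Import all_boot all_order all_algebra complex.
From mathcomp Require Import all_classical all_reals all_analysis.
From mathcomp Require Import ring.
Import Order.TTheory GRing.Theory Num.Theory numFieldNormedType.Exports.

Set Implicit Arguments.
Unset Strict Implicit.
Unset Printing Implicit Defensive.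

Local Open Scope classical_set_scope.
Local Open Scope ring_scope.

(* Fibrewise, the hypothesis that E meets the conjugate of its orthogonal only
   in 0 says that the Hermitian form g(x, conj y) is nondegenerate on E, so
   every x has a unique component P x in E with x - P x orthogonal to conj E.
   Then Phi = i (P - conj P conj) is real, skew and satisfies
   Phi^3 + Phi = 0.  In a local frame of E, P is given by the inverse of the
   Gram matrix of the Hermitian form, hence is smooth by Cramer's rule.
   Conversely the eigenspaces of Phi are the images of the projectors
   -(Phi^2 + i Phi)/2, -(Phi^2 - i Phi)/2 and 1 + Phi^2, which are polynomial in
   Phi, and the image of a smooth family of projectors is a subbundle. *)

(** The correspondence asks for smooth local frames of three bundles, while [E] supplies frames only
    for itself. Frames of the intersection S_c of E' with its conjugate are therefore never built
    from [E]: once Phi is available, [E] is recognized as its i-eigenbundle, and the direction from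
    Phi to E, applied to this Phi, yields all three bundles. The form of Phi is forced. It must act
    as i on E, as -i on conj E, and as 0 on S_c. The kernel of P is conj(E') and that of conj P conj
    is E', so S_c is their common kernel. Isotropy of E puts conj E inside conj(E'), hence P
    vanishes on conj E and the two projectors annihilate each other. Since the kernel of P is
    prescribed, no auxiliary metric or complement is chosen, and local formulas for P agree on
    overlaps. *)

Local Notation Re := complex.Re.
Local Notation Im := complex.Im.

(** * Smooth functions *)

Section Ck_local.
Variables (R : realType) (V W : normedModType R).
Implicit Types (f g : V -> W) (U : set V) (x : V).

(** Near [x] the zero map is an exact linear approximation. Adding such a germ to a function changes
    nothing near [x], which is how differentiability is shown below to depend only on the germ. *)
Lemma differentiable_near0 f x :
  (\forall y \near x, f y = 0) -> differentiable f x.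
Proof.
move=> f0.
have c0 : continuous (\0 : V -> W) by move=> y; exact: cvg_cst.
have e : f \o shift x = cst (f x) + (\0 : V -> W) +o_ 0 id.
  rewrite (nbhs_singleton f0); apply/eqaddoP => _/posnumP[e].
  have : \forall h \near (0 : V), f (h + x) = 0.
    have := f0; rewrite (near_shift 0) /= => f0'.
    by apply: filterS f0' => y /=; rewrite subr0.
  apply: filterS => h /= h0.
  by rewrite !fctE /= h0 addr0 subr0 normr0 mulr_ge0.
have d0 : 'd f x = \0 :> (V -> W) by exact: diff_unique.
by apply/diff_locallyP; split; rewrite d0.
Qed.

Lemma near_eq_differentiable f g x :
  (\forall y \near x, f y = g y) -> differentiable f x -> differentiable g x.
Proof.
move=> fg df; have -> : g = f + (g - f) by rewrite addrC subrK.
apply: differentiableD => //; apply: differentiable_near0.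
by apply: filterS fg => y; rewrite !fctE => ->; rewrite subrr.
Qed.

Lemma near_eq_continuous f g x :
  (\forall y \near x, f y = g y) ->
  {for x, continuous f} -> {for x, continuous g}.
Proof.
move=> fg cf; rewrite /prop_for /continuous_at -(nbhs_singleton fg).
by apply: cvg_trans cf; exact: near_eq_cvg.
Qed.

(** The derivatives in [Ck] are those of the total function, not of its restriction to [U], so the
    condition makes sense on a singleton and can be checked point by point. *)
Lemma CkP k U f : Ck k U f <-> forall x, U x -> Ck k [set x] f.
Proof.
elim: k f => [|k ih] f /=.
  by split=> [h x Ux _ ->|h x Ux]; [exact: h|exact: (h x Ux x)].
split=> [[d h] x Ux|h].
  split=> [_ ->|v]; first exact: d.
  by have /ih := h v; apply.
split=> [x Ux|v]; first exact: (h x Ux).1.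
by apply/ih => x Ux; exact: (h x Ux).2.
Qed.

Lemma sub_Ck k U U' f : U' `<=` U -> Ck k U f -> Ck k U' f.
Proof. by move=> UU' /CkP h; apply/CkP => x /UU'; exact: h. Qed.

Lemma near_eq_Ck k f g x :
  (\forall y \near x, f y = g y) -> Ck k [set x] f -> Ck k [set x] g.
Proof.
elim: k f g => [|k ih] f g fg /=.
  by move=> h _ ->; apply: near_eq_continuous fg _; exact: h.
move=> [d h]; split=> [_ ->|v].
  by apply: near_eq_differentiable fg _; exact: d.
apply: ih (h v).
(* The functions have equal germs at every point close to [x], so their derivatives agree on a
   neighbourhood and not only at [x]. *)
have := nbhs_interior fg; apply: filterS => y fgy; exact: near_eq_derive.
Qed.

Lemma eq_Ck k U f g : open U -> {in U, f =1 g} -> Ck k U f -> Ck k U g.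
Proof.
move=> oU fg /CkP h; apply/CkP => x Ux; apply: near_eq_Ck (h x Ux).
by apply: filterS (open_nbhs_nbhs (conj oU Ux)) => y Uy; apply: fg; rewrite inE.
Qed.

Lemma Ck_continuous k U f x : Ck k U f -> U x -> {for x, continuous f}.
Proof.
case: k => [|k] h Ux; first exact: h.
by apply: differentiable_continuous; exact: h.1.
Qed.

Lemma Ck_pred k U f : Ck k.+1 U f -> Ck k U f.
Proof.
elim: k f => [|k ih] f [d h]; first by move=> x Ux;
  apply: differentiable_continuous; exact: d.
by split=> // v; apply: ih; exact: h.
Qed.

Lemma Ck_cst k U (a : W) : Ck k U (cst a).
Proof.
elim: k a => [|k ih] a; first by move=> x _; exact: cst_continuous.
split=> // v.
rewrite (_ : (fun x => _) = cst 0)//.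
by apply/funext => x; rewrite derive_cst.
Qed.

Lemma CkD k U f g : open U -> Ck k U f -> Ck k U g -> Ck k U (f + g).
Proof.
move=> oU; elim: k f g => [|k ih] f g.
  by move=> cf cg x Ux; apply: cvgD; [exact: cf|exact: cg].
move=> [df hf] [dg hg]; split=> [x Ux|v].
  by apply: differentiableD; [exact: df|exact: dg].
apply: (eq_Ck oU _ (ih _ _ (hf v) (hg v))) => x; rewrite inE => Ux /=.
by rewrite fctE deriveD//; apply: diff_derivable; [exact: df|exact: dg].
Qed.

Lemma CkZ k U (a : R) f : open U -> Ck k U f -> Ck k U (a *: f).
Proof.
move=> oU; elim: k f => [|k ih] f.
  by move=> cf x Ux; apply: cvgZr; exact: cf.
move=> [df hf]; split=> [x Ux|v]; first by apply: differentiableZ; exact: df.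
apply: (eq_Ck oU _ (ih _ (hf v))) => x; rewrite inE => Ux /=.
by rewrite fctE deriveZ//; apply: diff_derivable; exact: df.
Qed.

Lemma Ck_sum k U (I : Type) (r : seq I) (P : pred I) (F : I -> V -> W) :
  open U -> (forall i, P i -> Ck k U (F i)) ->
  Ck k U (\sum_(i <- r | P i) F i).
Proof.
move=> oU h; elim/big_rec: _ => [|i f Pi hf]; first exact: Ck_cst.
by apply: CkD => //; exact: h.
Qed.

End Ck_local.

(** * Products and inverses of scalar functions *)

Section Ck_scalar.
Variables (R : realType) (V : normedModType R).
Implicit Types (f g : V -> R^o) (U : set V) (x : V).

Lemma CkM k U f g : open U -> Ck k U f -> Ck k U g ->
  Ck k U (fun x => f x * g x : R^o).
Proof.
move=> oU; elim: k f g => [|k ih] f g.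
  by move=> cf cg x Ux; apply: cvgM; [exact: cf|exact: cg].
move=> hf hg.
have [[df hf'] [dg hg']] := (hf, hg); split=> [x Ux|v].
  by apply: (@differentiableM _ _ f g); [exact: df|exact: dg].
(* The Leibniz rule pairs a derivative with an undifferentiated factor, which is why one order is
   given up by [Ck_pred]. *)
have h := CkD oU (ih _ _ (Ck_pred hf) (hg' v)) (ih _ _ (hf' v) (Ck_pred hg)).
apply: (eq_Ck oU _ h) => x; rewrite inE => Ux /=.
rewrite fctE (@deriveM _ _ f g); last 2 first.
- by apply: diff_derivable; exact: df.
- by apply: diff_derivable; exact: dg.
by congr (_ + _); exact: mulrC.
Qed.

(** The derivative of 1/f is a polynomial in 1/f and the derivative of f, so the induction on the
    order closes. *)
Lemma CkV k U f : open U -> (forall x, U x -> f x != 0) -> Ck k U f ->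
  Ck k U (fun x => (f x)^-1 : R^o).
Proof.
move=> oU f0; elim: k => [|k ih].
  by move=> cf x Ux; apply: cvgV; [exact: f0|exact: cf].
move=> hf.
have [df hf'] := hf; split=> [x Ux|v].
  by apply: (@differentiableV _ _ f); [exact: df|exact: f0].
have hV := ih (Ck_pred hf).
have h := CkZ (-1) oU (CkM oU (CkM oU hV hV) (hf' v)).
apply: (eq_Ck oU _ h) => x; rewrite inE => Ux /=.
rewrite fctE (@deriveV _ _ f); last 2 first.
- exact: f0.
- by apply: diff_derivable; exact: df.
by rewrite scaleN1r scaleNr -invfM -expr2.
Qed.

End Ck_scalar.

(** * Smoothness of row vectors, entry by entry *)

Section Ck_coord.
Variables (R : realType) (V : normedModType R) (n : nat).
Implicit Types (f : V -> 'rV[R]_n) (U : set V).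

Lemma differentiable_rowP f x :
  differentiable f x <-> forall j, differentiable (fun y => f y 0 j : R^o) x.
Proof.
split=> [df j|df].
  apply: (@differentiable_comp _ _ _ _ f (fun N : 'rV[R]_n => N 0 j
    : R^o)) => //.
  exact: differentiable_coord.
have -> : f = \sum_(j < n) (fun y => f y 0 j *: (delta_mx 0 j : 'rV[R]_n)).
  by apply/funext => y; rewrite fct_sumE -row_sum_delta.
apply: differentiable_sum => j; exact: (@differentiableZl _ _ _ (fun y =>
  f y 0 j)).
Qed.

Lemma Ck_rowP k U f :
  open U -> Ck k U f <-> forall j, Ck k U (fun y => f y 0 j : R^o).
Proof.
move=> oU; elim: k f => [|k ih] f.
  split=> [cf j x Ux|cf x Ux].
    apply: (@continuous_comp _ _ _ f (fun N : 'rV[R]_n => N 0 j : R^o));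
      first exact: cf.
    exact: coord_continuous.
  have e : f = \sum_(j < n) (fun y => f y 0 j *: (delta_mx 0 j : 'rV[R]_n)).
    by apply/funext => y; rewrite fct_sumE -row_sum_delta.
  rewrite e; apply: (Ck_sum (k := 0)) Ux => // j _ y Uy.
  by apply: cvgZl; exact: cf.
have D v x j : differentiable f x ->
    ('D_v f x) 0 j = 'D_v (fun y => f y 0 j : R^o) x.
  by move=> df; rewrite derive_mx ?mxE//; exact: diff_derivable.
split=> [[df hf] j|h].
  split=> [x Ux|v]; first by have /differentiable_rowP := df x Ux; apply.
  have /ih /(_ j) := hf v; apply: eq_Ck => // x; rewrite inE => Ux /=.
  by apply: D; exact: df.
have df x : U x -> differentiable f x.
  by move=> Ux; apply/differentiable_rowP => j; exact: (h j).1.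
split=> // v; apply/ih => j.
apply: (eq_Ck oU _ ((h j).2 v)) => x; rewrite inE => Ux /=.
by rewrite D//; exact: df.
Qed.

End Ck_coord.

(** * Smooth complex-valued functions and matrices *)

Section Csmooth.
Variables (R : realType) (V : normedModType R).
Implicit Types (f g : V -> R[i]) (U : set V).

Definition csmooth U f :=
  smooth_on U (fun x => Re (f x) : R^o) /\ smooth_on U (fun x => Im (f x)
    : R^o).

Lemma sub_csmooth U U' f : U' `<=` U -> csmooth U f -> csmooth U' f.
Proof. by move=> UU' [r i]; split=> k; apply: sub_Ck UU' _;
  [exact: r|exact: i]. Qed.

Lemma csmooth_local U f :
  (forall x, U x -> exists2 U', U' x & csmooth U' f) -> csmooth U f.
Proof.
move=> h; split=> k; apply/CkP => x Ux; have [U' U'x [hr hi]] := h x Ux.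
  by have /CkP := hr k; apply.
by have /CkP := hi k; apply.
Qed.

Lemma eq_csmooth U f g :
  open U -> {in U, f =1 g} -> csmooth U f -> csmooth U g.
Proof.
move=> oU fg [r i]; split=> k; [apply: eq_Ck (r k)|apply: eq_Ck (i k)] => //;
by move=> x /fg ->.
Qed.

Lemma csmooth_cst U (a : R[i]) : csmooth U (fun=> a).
Proof. by split=> k; exact: Ck_cst. Qed.

Variable U : set V.
Hypothesis oU : open U.

Lemma csmoothD f g : csmooth U f -> csmooth U g ->
  csmooth U (fun x => f x + g x).
Proof.
move=> [fr fi] [gr gi]; split=> k.
- apply: (eq_Ck oU _ (CkD oU (fr k) (gr k))) => x _.
  by rewrite fctE; case: (f x) (g x) => [a b] [c d].
- apply: (eq_Ck oU _ (CkD oU (fi k) (gi k))) => x _.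
  by rewrite fctE; case: (f x) (g x) => [a b] [c d].
Qed.

Lemma csmoothM f g : csmooth U f -> csmooth U g ->
  csmooth U (fun x => f x * g x).
Proof.
move=> [fr fi] [gr gi]; split=> k.
- apply: (eq_Ck oU _ (CkD oU (CkM oU (fr k) (gr k))
    (CkZ (-1) oU (CkM oU (fi k) (gi k))))) => x _.
  by rewrite !fctE scaleN1r; case: (f x) (g x) => [a b] [c d].
- apply: (eq_Ck oU _ (CkD oU (CkM oU (fr k) (gi k))
    (CkM oU (fi k) (gr k)))) => x _.
  by rewrite !fctE; case: (f x) (g x) => [a b] [c d].
Qed.

Lemma csmooth_conj f : csmooth U f -> csmooth U (fun x => conjc (f x)).
Proof.
move=> [fr fi]; split=> k.
  by apply: (eq_Ck oU _ (fr k)) => x _; case: (f x).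
apply: (eq_Ck oU _ (CkZ (-1) oU (fi k))) => x _.
by rewrite fctE scaleN1r; case: (f x).
Qed.

Lemma csmoothV f : (forall x, U x -> f x != 0) -> csmooth U f ->
  csmooth U (fun x => (f x)^-1).
Proof.
move=> f0 [fr fi].
(* The squared modulus: the inverse of [f x] is its conjugate divided by [N x], which reduces the
   claim to the real [CkV]. *)
pose N x : R^o := Re (f x) * Re (f x) + Im (f x) * Im (f x).
have N0 x : U x -> N x != 0.
  move=> Ux; have := f0 x Ux; rewrite /N -!expr2; case: (f x) => [a b] /=.
  rewrite eq_complex /= negb_and paddr_eq0 ?sqr_ge0// !sqrf_eq0.
  by rewrite negb_and.
have hN k : Ck k U (fun x => (N x)^-1 : R^o).
  by apply: CkV => //; exact: (CkD oU (CkM oU (fr k) (fr k)) (CkM oU (fi k) (fi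
    k))).
split=> k.
  apply: (eq_Ck oU _ (CkM oU (fr k) (hN k))) => x _.
  by rewrite /N -!expr2; case: (f x).
apply: (eq_Ck oU _ (CkZ (-1) oU (CkM oU (fi k) (hN k)))) => x _.
by rewrite fctE scaleN1r /N -!expr2; case: (f x).
Qed.

Lemma csmooth_sum (I : Type) (r : seq I) (P : pred I) (F : I -> V -> R[i]) :
  (forall i, P i -> csmooth U (F i)) ->
  csmooth U (fun x => \sum_(i <- r | P i) F i x).
Proof.
move=> h; elim: r => [|i r ih].
  by apply: (eq_csmooth oU _ (csmooth_cst U 0)) => x _; rewrite big_nil.
have [Pi|nPi] := boolP (P i).
  apply: (eq_csmooth oU _ (csmoothD (h i Pi) ih)) => x _.
  by rewrite big_cons Pi.
by apply: (eq_csmooth oU _ ih) => x _; rewrite big_cons (negPf nPi).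
Qed.

Lemma csmooth_prod (I : Type) (r : seq I) (P : pred I) (F : I -> V -> R[i]) :
  (forall i, P i -> csmooth U (F i)) ->
  csmooth U (fun x => \prod_(i <- r | P i) F i x).
Proof.
move=> h; elim: r => [|i r ih].
  by apply: (eq_csmooth oU _ (csmooth_cst U 1)) => x _; rewrite big_nil.
have [Pi|nPi] := boolP (P i).
  apply: (eq_csmooth oU _ (csmoothM (h i Pi) ih)) => x _.
  by rewrite big_cons Pi.
by apply: (eq_csmooth oU _ ih) => x _; rewrite big_cons (negPf nPi).
Qed.

Definition csmooth_mx m n (A : V -> 'M[R[i]]_(m, n)) :=
  forall i j, csmooth U (fun x => A x i j).

Lemma csmooth_mulmx m n p (A : V -> 'M[R[i]]_(m, n)) (B : V ->
  'M[R[i]]_(n, p)) :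
  csmooth_mx A -> csmooth_mx B -> csmooth_mx (fun x => A x *m B x).
Proof.
move=> hA hB i j.
apply: (eq_csmooth oU (f := fun x => \sum_k A x i k * B x k j)) => [x _|].
  by rewrite mxE.
by apply: csmooth_sum => k _; apply: csmoothM.
Qed.

Lemma csmooth_det n (A : V -> 'M[R[i]]_n) :
  csmooth_mx A -> csmooth U (fun x => \det (A x)).
Proof.
move=> hA; apply: csmooth_sum => s _; apply: csmoothM.
  exact: csmooth_cst.
by apply: csmooth_prod => i _; exact: hA.
Qed.

Lemma csmooth_invmx n (A : V -> 'M[R[i]]_n) :
  (forall x, U x -> A x \in unitmx) -> csmooth_mx A ->
  csmooth_mx (fun x => invmx (A x)).
Proof.
move=> uA hA i j.
(* Entry (i, j) of the adjugate is the cofactor at (j, i), hence the exchanged indices. *)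
have h : csmooth U (fun x => (\det (A x))^-1 *
    ((-1) ^+ (j + i) * \det (row' j (col' i (A x))))).
  apply: csmoothM.
    apply: csmoothV; last exact: csmooth_det.
    by move=> x /uA; rewrite unitmxE unitfE.
  apply: csmoothM; first exact: csmooth_cst.
  apply: csmooth_det => a b.
  apply: (eq_csmooth oU (f := fun x => A x (lift j a) (lift i b))) => [x _|].
    by rewrite !mxE.
  exact: hA.
apply: (eq_csmooth oU _ h) => x; rewrite inE => Ux.
by rewrite /invmx uA// !mxE.
Qed.

End Csmooth.

(** * Coordinates on the big tangent bundle *)

Section Linear_prop.
Variables (K : nzRingType) (V W : lmodType K) (f : V -> W).
Hypothesis lf : linear f.
(** Linearity occurs throughout as a proposition about a bare function; this packaging makes the
    bundled theory available for it. *)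
Let g : {linear V -> W} := HB.pack f (GRing.isLinear.Build _ _ _ _ _ lf).

Lemma lin0 : f 0 = 0. Proof. exact: (linear0 g). Qed.
Lemma linD x y : f (x + y) = f x + f y. Proof. exact: (linearD g). Qed.
Lemma linN x : f (- x) = - f x. Proof. exact: (linearN g). Qed.
Lemma linB x y : f (x - y) = f x - f y. Proof. exact: (linearB g). Qed.
Lemma linZ a x : f (a *: x) = a *: f x. Proof. exact: (linearZ_LR g). Qed.
Lemma lin_sum (I : Type) (r : seq I) (P : pred I) (c : I -> K) (v : I -> V) :
  f (\sum_(i <- r | P i) c i *: v i) = \sum_(i <- r | P i) c i *: f (v i).
Proof.
rewrite -[LHS]/(g _) linear_sum; apply: eq_bigr => i _; exact: linZ.
Qed.

End Linear_prop.

Section Coordinates.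
Variables (R : realType) (m : nat) (M : manifold R m).
Implicit Types (i j : chart_index M) (p q : M) (U : set M).

Definition chart_img i U := chart i @` (U `&` chart_dom i).

(** Within the open image of the chart domain, this set is the preimage of [U] under the continuous
    [chart_inv i]. *)
Lemma open_chart_img i U : open U -> open (chart_img i U).
Proof.
move=> oU; rewrite openE => _ [q [Uq qi] <-] /=; rewrite /interior.
have q_img : (chart i @` chart_dom i) (chart i q) by exists q.
have n1 : \forall y \near chart i q, (chart i @` chart_dom i) y.
  by apply: open_nbhs_nbhs; split=> //; exact: chart_img_open.
have n2 : \forall y \near chart i q, U (chart_inv i y).
  apply: (chart_inv_continuous q_img); rewrite chartK//.
  by apply: open_nbhs_nbhs; split.
apply: filterS2 n1 n2 => _ [q' q'i <-]; rewrite chartK// => Uq'.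
by exists q'.
Qed.

Lemma sub_chart_img i U U' : U' `<=` U -> chart_img i U' `<=` chart_img i U.
Proof. by move=> UU' _ [q [/UU' Uq qi] <-]; exists q. Qed.

Lemma dual_linear (V : lmodType R) (f : dual V) : linear f.
Proof. by have /asboolP := dual_funP f. Qed.

Lemma tvec_linear i p : chart_dom i p -> linear (@tvec R m M i p).
Proof.
move=> pi a u v.
rewrite -[LHS](tangent_compK _ pi) -[RHS](tangent_compK _ pi); congr tvec.
by rewrite -[RHS]/(a *: tvec i p u i + tvec i p v i) !tvecK.
Qed.

Lemma tvec_sum i p w : chart_dom i p ->
  tvec i p w = \sum_k w 0 k *: tvec i p (delta_mx 0 k).
Proof.
move=> pi; rewrite [in LHS](row_sum_delta w).
by rewrite (lin_sum (tvec_linear pi)).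
Qed.

Definition covec_fun i p (w : 'rV[R]_m) (X : tangent p) : R^o :=
  \sum_k w 0 k * X i 0 k.

Lemma covec_subproof i p w : covec_fun i w \in @linear_form R (tangent p).
Proof.
apply/asboolP => a X Y; rewrite /covec_fun.
transitivity (\sum_k w 0 k * (a *: X i + Y i) 0 k); first by [].
rewrite scaler_sumr -big_split /=.
by apply: eq_bigr => k _; rewrite !mxE mulrDr mulrCA.
Qed.

Definition covec i p w : cotangent p := Dual (covec_subproof i p w).

Lemma cotangent_compE i p (a : cotangent p) X : chart_dom i p ->
  a X = \sum_k cotangent_comp i a 0 k * X i 0 k.
Proof.
move=> pi; rewrite -[in LHS](tangent_compK X pi) tvec_sum//.
by rewrite (lin_sum (dual_linear a)); apply: eq_bigr => k _; rewrite mxE mulrC.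
Qed.

Lemma cotangent_comp_linear i p : linear (@cotangent_comp R m M i p).
Proof. by move=> a f g; apply/rowP => k; rewrite !mxE. Qed.

Definition rcoord i p (x : bigT p) : 'rV[R]_(m + m) :=
  row_mx (x.1 i) (cotangent_comp i x.2).

Definition of_rcoord i p (w : 'rV[R]_(m + m)) : bigT p :=
  (tvec i p (lsubmx w), covec i p (rsubmx w)).

Lemma rcoord_linear i p : linear (@rcoord i p).
Proof.
move=> a x y; rewrite /rcoord scale_row_mx add_row_mx.
by rewrite cotangent_comp_linear.
Qed.

Lemma rcoordK i p (x : bigT p) : chart_dom i p ->
  of_rcoord i p (rcoord i x) = x.
Proof.
move=> pi; case: x => X a; rewrite /of_rcoord /rcoord row_mxKl row_mxKr /=.
congr pair; first exact: tangent_compK.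
apply/val_inj/funext => Y /=; rewrite (cotangent_compE a Y pi).
by apply: eq_bigr => k _.
Qed.

(* Vectors transform by the inverse Jacobian of [transition j i] rather than by
   the Jacobian of [transition i j]: the former is a function of the coordinates
   in chart j alone, so its smoothness needs no chain rule. *)
Definition rtrans i j q : 'M[R]_(m + m) :=
  let J := 'J (transition j i) (chart j q) in block_mx (invmx J) 0 0 J^T.

(** The cocycle identity along [j], [i], [j], with matrices acting on rows from the right. It
    provides the invertibility on which [rtrans] relies. *)
Lemma jacobian_transition i j q : chart_dom i q -> chart_dom j q ->
  'J (transition j i) (chart j q) *m 'J (transition i j) (chart i q) = 1%:M.
Proof.
move=> qi qj; apply/row_matrixP => k; rewrite row_mul !rowE !mul_rV_lin1 /=.
by rewrite transition_cocycle// transition_id// mulmx1.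
Qed.

(** Covectors get the transposed Jacobian because their k-th component in chart [j] is the value on
    the k-th coordinate vector of [j], whose components in chart [i] form row k. For vectors, both
    sides are multiplied by the Jacobian and compared in chart [i]. *)
Lemma rcoord_const i j q w : chart_dom i q -> chart_dom j q ->
  rcoord j (of_rcoord i q w) = w *m rtrans i j q.
Proof.
move=> qi qj; rewrite /rtrans -{2}[w]hsubmxK mul_row_block !mulmx0 addr0 add0r.
have uJ := (mulmx1_unit (jacobian_transition qi qj)).1.
congr row_mx.
  apply: (can_inj (mulmxK uJ)); rewrite mulmxKV//= mul_rV_lin1 /= tvecE//.
  by rewrite transition_cocycle// transition_id.
apply/rowP => k; rewrite !mxE /= /covec_fun; apply: eq_bigr => l _.
by rewrite tvecE// !mxE.
Qed.

Lemma of_rcoordK i p w : chart_dom i p -> rcoord i (of_rcoord i p w) = w.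
Proof.
move=> pi; rewrite rcoord_const// /rtrans.
have -> : 'J (transition i i) (chart i p) = 1%:M.
  by apply/row_matrixP => k; rewrite !rowE mul_rV_lin1 /= transition_id//
    mulmx1.
by rewrite trmx1 invmx1 -scalar_mx_block mulmx1.
Qed.

Local Notation toC := (map_mx (real_complex R)).

Definition ccoord i p (x : bigTc p) : 'rV[R[i]]_(m + m) :=
  toC (rcoord i x.1) + 'i%C *: toC (rcoord i x.2).

Definition of_ccoord i p (w : 'rV[R[i]]_(m + m)) : bigTc p :=
  (of_rcoord i p (map_mx (@complex.Re R) w), of_rcoord i p (map_mx (@complex.Im
    R) w)).

Lemma Re_toC n (u v : 'rV[R]_n) : map_mx (@complex.Re R) (toC u
  + 'i%C *: toC v) = u.
Proof. by apply/rowP => k; rewrite !mxE /= mul0r mul1r subrr addr0. Qed.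

Lemma Im_toC n (u v : 'rV[R]_n) : map_mx (@complex.Im R) (toC u
  + 'i%C *: toC v) = v.
Proof. by apply/rowP => k; rewrite !mxE /= mul0r mul1r !add0r. Qed.

Lemma toC_ReIm n (w : 'rV[R[i]]_n) : toC (map_mx (@complex.Re R) w)
  + 'i%C *: toC (map_mx (@complex.Im R) w) = w.
Proof. by apply/rowP => k; rewrite !mxE -complexE. Qed.

Lemma ccoord_linear i p : linear (@ccoord i p).
Proof.
move=> [a b] x y; rewrite /ccoord.
rewrite -[RHS]toC_ReIm.
have rD := linD (@rcoord_linear i p); have rZ := linZ (@rcoord_linear i p).
congr (toC _ + 'i%C *: toC _); apply/rowP => k /=.
  by rewrite rD -scaleNr rD !rZ !mxE /=; ring.
by rewrite !rD !rZ !mxE /=; ring.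
Qed.

Lemma ccoordK i p (x : bigTc p) : chart_dom i p ->
  of_ccoord i p (ccoord i x) = x.
Proof.
move=> pi; case: x => x y; rewrite /of_ccoord /ccoord Re_toC Im_toC /=.
by rewrite !rcoordK.
Qed.

Lemma ccoord_const i j q w : chart_dom i q -> chart_dom j q ->
  ccoord j (of_ccoord i q w) = w *m toC (rtrans i j q).
Proof.
move=> qi qj; rewrite /ccoord /= !rcoord_const// !map_mxM.
by rewrite scalemxAl -mulmxDl toC_ReIm.
Qed.

Lemma of_ccoordK i p w : chart_dom i p -> ccoord i (of_ccoord i p w) = w.
Proof. by move=> pi; rewrite /ccoord !of_rcoordK// toC_ReIm. Qed.

Lemma ccoord_inj i p : chart_dom i p -> injective (@ccoord i p).
Proof. by move=> pi; apply: (can_inj (g := of_ccoord i p)) => x;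
  exact: ccoordK. Qed.

(** * Smooth sections in coordinates *)

Lemma rsectionP U (s : forall p, bigT p) : open U ->
  smooth_section U s <-> forall i k,
    smooth_on (chart_img i U) (fun y => rcoord i (s (chart_inv i y)) 0 k : R^o).
Proof.
move=> oU; split=> [h i k n|h i].
  have oI : open (chart_img i U) by exact: open_chart_img.
  have [h1 h2] := h i; case: (split_ordP k) => l ->.
    have /(Ck_rowP n _ oI) /(_ l) := h1 n; apply: eq_Ck => // y _.
    by rewrite /rcoord row_mxEl.
  have /(Ck_rowP n _ oI) /(_ l) := h2 n; apply: eq_Ck => // y _.
  by rewrite /rcoord row_mxEr.
have oI : open (chart_img i U) by exact: open_chart_img.
split=> n; apply/(Ck_rowP n _ oI) => l.
  by apply: eq_Ck (h i (lshift m l) n) => // y _; rewrite /rcoord row_mxEl.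
by apply: eq_Ck (h i (rshift m l) n) => // y _; rewrite /rcoord row_mxEr.
Qed.

Lemma Re_ccoord i p (x : bigTc p) k : Re (ccoord i x 0 k) = rcoord i x.1 0 k.
Proof. by rewrite !mxE /= mul0r mul1r subrr addr0. Qed.

Lemma Im_ccoord i p (x : bigTc p) k : Im (ccoord i x 0 k) = rcoord i x.2 0 k.
Proof. by rewrite !mxE /= mul0r mul1r !add0r. Qed.

Lemma csectionP U (s : forall p, bigTc p) : open U ->
  smooth_csection U s <-> forall i,
    csmooth_mx (chart_img i U) (fun y => ccoord i (s (chart_inv i y))).
Proof.
move=> oU; split.
  move=> [/(rsectionP _ oU) h1 /(rsectionP _ oU) h2] i z k; rewrite (ord1 z).
  have oI : open (chart_img i U) by exact: open_chart_img.
  split=> n.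
    by apply: eq_Ck (h1 i k n) => // y _; rewrite Re_ccoord.
  by apply: eq_Ck (h2 i k n) => // y _; rewrite Im_ccoord.
move=> h; split; apply/(rsectionP _ oU) => i k n.
all: have oI : open (chart_img i U) by exact: open_chart_img.
  by apply: eq_Ck ((h i 0 k).1 n) => // y _; rewrite Re_ccoord.
by apply: eq_Ck ((h i 0 k).2 n) => // y _; rewrite Im_ccoord.
Qed.

Lemma chart_imgK i U y : chart_img i U y -> U (chart_inv i y).
Proof. by move=> [q [Uq qi] <-]; rewrite chartK. Qed.

Lemma chart_img_dom i U y : chart_img i U y -> chart_dom i (chart_inv i y).
Proof. by move=> [q [Uq qi] <-]; rewrite chartK. Qed.

Lemma eq_csection U (s t : forall p, bigTc p) : open U ->
  (forall p, U p -> s p = t p) -> smooth_csection U s -> smooth_csection U t.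
Proof.
move=> oU st /(csectionP _ oU) h; apply/(csectionP _ oU) => i a b.
apply: eq_csmooth (h i a b); first exact: open_chart_img.
by move=> y; rewrite inE => /chart_imgK /st ->.
Qed.

Lemma sub_csection U U' (s : forall p, bigTc p) : open U -> open U' ->
  U' `<=` U -> smooth_csection U s -> smooth_csection U' s.
Proof.
move=> oU oU' UU' /(csectionP _ oU) h; apply/(csectionP _ oU') => i a b.
by apply: sub_csmooth (h i a b); exact: sub_chart_img.
Qed.

Lemma csection_local U (s : forall p, bigTc p) : open U ->
  (forall p, U p -> exists U', [/\ open U', U' p & smooth_csection U' s]) ->
  smooth_csection U s.
Proof.
move=> oU h; apply/(csectionP _ oU) => i a b.
apply: csmooth_local => _ [p [Up pi] <-].
have [U' [oU' U'p /(csectionP _ oU') h']] := h p Up.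
by exists (chart_img i U'); [exists p|exact: h'].
Qed.

Definition cfun_smooth U (c : M -> R[i]) := forall i,
  csmooth (chart_img i U) (fun y => c (chart_inv i y)).

Lemma cfun_smooth_cst U a : cfun_smooth U (fun=> a).
Proof. by move=> i; exact: csmooth_cst. Qed.

Lemma csectionDZ U (c : M -> R[i]) (s t : forall p, bigTc p) : open U ->
  cfun_smooth U c -> smooth_csection U s -> smooth_csection U t ->
  smooth_csection U (fun p => c p *: s p + t p).
Proof.
move=> oU hc /(csectionP _ oU) hs /(csectionP _ oU) ht.
apply/(csectionP _ oU) => i a b.
have oI : open (chart_img i U) by exact: open_chart_img.
apply: (eq_csmooth oI _ (csmoothD oI (csmoothM oI (hc i) (hs i a b)) (ht i a
  b))).
by move=> y _; rewrite ccoord_linear !mxE.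
Qed.

Lemma csection0 U : open U -> smooth_csection U (fun=> 0).
Proof.
move=> oU; apply/(csectionP _ oU) => i a b.
have oI : open (chart_img i U) by exact: open_chart_img.
apply: (eq_csmooth oI _ (csmooth_cst _ 0)) => y _.
by rewrite (lin0 (@ccoord_linear i _)) mxE.
Qed.

Lemma csectionD U (s t : forall p, bigTc p) : open U ->
  smooth_csection U s -> smooth_csection U t ->
  smooth_csection U (fun p => s p + t p).
Proof.
move=> oU hs ht.
apply: (eq_csection oU _ (csectionDZ oU (cfun_smooth_cst U 1) hs ht)) => p _.
by rewrite scale1r.
Qed.

Lemma csectionZ U (c : M -> R[i]) (s : forall p, bigTc p) : open U ->
  cfun_smooth U c -> smooth_csection U s ->
  smooth_csection U (fun p => c p *: s p).
Proof.
move=> oU hc hs.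
apply: (eq_csection oU _ (csectionDZ oU hc hs (csection0 oU))) => p _.
by rewrite addr0.
Qed.

Lemma csection_sum U k (c : 'I_k -> M -> R[i]) (s : 'I_k -> forall p, bigTc p) :
  open U -> (forall a, cfun_smooth U (c a)) ->
  (forall a, smooth_csection U (s a)) ->
  smooth_csection U (fun p => \sum_(a < k) c a p *: s a p).
Proof.
move=> oU hc hs; suff h r : smooth_csection U (fun p =>
  \sum_(a <- r) c a p *: s a p).
  by have := h (index_enum _).
elim: r => [|a r ih].
  by apply: (eq_csection oU _ (csection0 oU)) => p _; rewrite big_nil.
apply: (eq_csection oU _ (csectionDZ oU (hc a) (hs a) ih)) => p _.
by rewrite big_cons.
Qed.

Lemma csection_conj U (s : forall p, bigTc p) : open U ->
  smooth_csection U s -> smooth_csection U (fun p => cconj (s p)).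
Proof.
move=> oU /(csectionP _ oU) hs; apply/(csectionP _ oU) => i a b.
have oI : open (chart_img i U) by exact: open_chart_img.
apply: (eq_csmooth oI _ (csmooth_conj oI (hs i a b))) => y _.
rewrite (ord1 a) /=.
have N q := linN (@rcoord_linear i q).
apply/eqP; rewrite eq_complex [Re (ccoord _ _ _ _)]Re_ccoord.
rewrite [Im (ccoord i (cconj _) _ _)]Im_ccoord /= N [fun_of_matrix (- _) _
  _]mxE.
rewrite -Re_ccoord -Im_ccoord.
by case: (ccoord i (s (chart_inv i y)) 0 b) => u v; rewrite /= !eqxx.
Qed.

(** Smoothness is tested in every chart, so coordinates constant in chart [i] have to be followed
    into each chart [j], where they become [w] times the transition matrix. These sections are the
    local frames to which smooth endomorphisms are applied later. *)
Lemma csection_const i w : smooth_csection (chart_dom i) (fun q =>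
  of_ccoord i q w).
Proof.
have oU := chart_dom_open i; apply/(csectionP _ oU) => j.
set I := chart_img j (chart_dom i).
have oI : open I by exact: open_chart_img.
pose J y := 'J (transition j i) y.
have e : {in I, (fun y => w *m toC (block_mx (invmx (J y)) 0 0 (J y)^T)) =1
    fun y => ccoord j (of_ccoord i (chart_inv j y) w)}.
  move=> y; rewrite inE => -[q [qi qj] <-] /=.
  by rewrite chartK// ccoord_const.
have uJ y : I y -> toC (J y) \in unitmx.
  move=> [q [qi qj] <-]; rewrite map_unitmx.
  exact: (mulmx1_unit (jacobian_transition qi qj)).1.
have sJ : csmooth_mx I (fun y => toC (J y)).
  move=> a b; split=> n; last first.
    by apply: (eq_Ck oI _ (@Ck_cst _ _ _ n I 0)) => y _; rewrite mxE.
  have I_sub : I `<=` chart j @` (chart_dom j `&` chart_dom i).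
    by move=> _ [q [qi qj] <-]; exists q.
  (* Row [a] of the Jacobian is the derivative in direction [delta_mx 0 a], so order n of its
     entries costs order n + 1 of the transition map. *)
  have h := sub_Ck I_sub (transition_smooth j i n.+1).
  have /(Ck_rowP n _ oI) /(_ b) := h.2 (delta_mx 0 a).
  apply: eq_Ck => // y; rewrite inE => Iy.
  by rewrite !mxE /= deriveE//; exact: h.1.
have sB : csmooth_mx I (fun y => toC (block_mx (invmx (J y)) 0 0 (J y)^T)).
  move=> a b; apply: (eq_csmooth oI (f := fun y =>
    block_mx (invmx (toC (J y))) 0 0 (toC (J y))^T a b)) => [y _|].
    by rewrite map_block_mx map_invmx map_trmx !map_mx0.
  case: (split_ordP a) => a' ->; case: (split_ordP b) => b' ->.
  - apply: (eq_csmooth oI (f := fun y => invmx (toC (J y)) a' b')) => [y _|].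
      by rewrite block_mxEul.
    exact: (csmooth_invmx oI uJ sJ).
  - by apply: (eq_csmooth oI _ (csmooth_cst _ 0)) => y _;
    rewrite block_mxEur mxE.
  - by apply: (eq_csmooth oI _ (csmooth_cst _ 0)) => y _;
    rewrite block_mxEdl mxE.
  - apply: (eq_csmooth oI (f := fun y => toC (J y) b' a')) => [y _|].
      by rewrite block_mxEdr [in RHS]mxE.
    exact: sJ.
have := csmooth_mulmx oI (A := fun=> w) (fun a b => csmooth_cst I (w a b)) sB.
by move=> h a b; apply: (eq_csmooth oI _ (h a b)) => y /e /= ->.
Qed.

(** In every chart the metric has constant coefficients: it is half the sum of the two pairings of
    vector with covector components. *)
Lemma cfun_smooth_form U (s t : forall p, bigTc p) : open U ->
  smooth_csection U s -> smooth_csection U t ->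
  cfun_smooth U (fun p => cform (@metric R m M p) (s p) (t p)).
Proof.
move=> oU [s1 s2] [t1 t2] i.
have oI : open (chart_img i U) by exact: open_chart_img.
have h (u v : forall p, bigT p) : smooth_section U u -> smooth_section U v ->
    smooth_on (chart_img i U)
      (fun y => metric (u (chart_inv i y)) (v (chart_inv i y)) : R^o).
  move=> hu hv n; have [hu1 hu2] := hu i; have [hv1 hv2] := hv i.
  have hp (f g : 'rV[R]_m -> 'rV[R]_m) : smooth_on (chart_img i U) f ->
      smooth_on (chart_img i U) g ->
      Ck n (chart_img i U) (\sum_(k < m) (fun y => f y 0 k * g y 0 k : R^o)).
    move=> hf hg; apply: Ck_sum => // k _.
    by apply: CkM => //; move: k; apply/(Ck_rowP n _ oI).
  apply: (eq_Ck oI _ (CkZ 2^-1 oI (CkD oI (hp _ _ hu2 hv1) (hp _ _ hv2 hu1)))).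
  move=> y; rewrite inE => /chart_img_dom yi.
  rewrite /metric !fctE !fct_sumE.
  by rewrite !(cotangent_compE _ _ yi).
split=> n.
- apply: (eq_Ck oI _ (CkD oI (h _ _ s1 t1 n) (CkZ (-1) oI (h _ _ s2 t2 n)))).
  by move=> y _; rewrite !fctE scaleN1r.
- by apply: (eq_Ck oI _ (CkD oI (h _ _ s1 t2 n) (h _ _ s2 t1 n))).
Qed.

End Coordinates.

(** * Images of smooth projectors *)

Section Projector_bundle.
Variables (R : realType) (m : nat) (M : manifold R m).
Implicit Types (i j : chart_index M) (p q : M) (U : set M).

Lemma of_ccoord_linear i q : chart_dom i q -> linear (@of_ccoord R m M i q).
Proof.
move=> qi a u v; apply: (ccoord_inj qi).
by rewrite ccoord_linear !of_ccoordK.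
Qed.

Definition coord_mx i q (f : bigTc q -> bigTc q) : 'M[R[i]]_(m + m) :=
  \matrix_a ccoord i (f (of_ccoord i q (delta_mx 0 a))).

Lemma coord_mxE i q (f : bigTc q -> bigTc q) x : chart_dom i q -> linear f ->
  ccoord i (f x) = ccoord i x *m coord_mx i f.
Proof.
move=> qi lf.
have lg : linear (fun w => ccoord i (f (of_ccoord i q w))).
  by move=> a u v; rewrite of_ccoord_linear// lf ccoord_linear.
pose g : {linear _ -> _} := HB.pack (fun w => ccoord i (f (of_ccoord i q w)))
  (GRing.isLinear.Build _ _ _ _ _ lg).
rewrite -[x in LHS](ccoordK _ qi) -[LHS]/(g (ccoord i x)) -mul_rV_lin1.
congr (_ *m _); apply/row_matrixP => a.
by rewrite rowK rowE mul_rV_lin1.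
Qed.

Lemma csmooth_coord_mx U i (Q : forall p, bigTc p -> bigTc p) : open U ->
  U `<=` chart_dom i ->
  (forall U s, open U -> smooth_csection U s ->
     smooth_csection U (fun p => Q p (s p))) ->
  csmooth_mx (chart_img i U) (fun y => coord_mx i (Q (chart_inv i y))).
Proof.
move=> oU Ui sQ a b.
have oI : open (chart_img i U) by exact: open_chart_img.
have oi := chart_dom_open i.
have := sQ U _ oU (sub_csection oi oU Ui (csection_const i (delta_mx 0 a))).
move=> /(csectionP _ oU) /(_ i 0 b); apply: eq_csmooth => // y _.
by rewrite [RHS]mxE.
Qed.

Lemma ccoord_sum i q k (c : 'I_k -> R[i]) (s : 'I_k -> bigTc q) :
  ccoord i (\sum_(a < k) c a *: s a) =
  (\row_a c a) *m (\matrix_a ccoord i (s a)).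
Proof.
rewrite (lin_sum (@ccoord_linear R m M i q)) mulmx_sum_row.
by apply: eq_bigr => a _; rewrite rowK mxE.
Qed.

(* With A q the matrix of the projector at q, the endomorphism
   G q = A p A q + (1 - A p) (1 - A q) satisfies A p G q = G q A q and
   G p = 1, so for q near p it carries the image of A p onto that of A q. *)
Lemma projector_subbundle (Q : forall p, bigTc p -> bigTc p) :
  (forall p, linear (Q p)) ->
  (forall p x, Q p (Q p x) = Q p x) ->
  (forall U s, open U -> smooth_csection U s ->
     smooth_csection U (fun p => Q p (s p))) ->
  @subbundle R m M (fun p => [set x | Q p x = x]).
Proof.
move=> lQ idQ sQ p.
have [i pi] := chart_cover p.
pose A q := coord_mx i (Q q).
have AE q x : chart_dom i q -> ccoord i (Q q x) = ccoord i x *m A q.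
  by move=> qi; exact: coord_mxE.
have rA q a : row a (A q) = ccoord i (Q q (of_ccoord i q (delta_mx 0 a))).
  exact: rowK.
have oi := chart_dom_open i.
pose I := chart_img i (chart_dom i).
have oI : open I by exact: open_chart_img.
have sA : csmooth_mx I (fun y => A (chart_inv i y)) by exact: csmooth_coord_mx.
clearbody A.
have AA q : chart_dom i q -> A q *m A q = A q.
  by move=> qi; apply/row_matrixP => a; rewrite row_mul rA -AE// idQ.
have AAp := AA p pi.
pose G q := A p *m A q + (1%:M - A p) *m (1%:M - A q).
have AG q : A p *m G q = A p *m A q.
  by rewrite mulmxDr !mulmxA AAp (mulmxBr (A p)) mulmx1 AAp subrr mul0mx addr0.
have GA q : chart_dom i q -> G q *m A q = A p *m A q.
  move=> /AA AAq; rewrite mulmxDl -!mulmxA AAq (mulmxBl 1%:M (A q)) mul1mx AAq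
    subrr.
  by rewrite mulmx0 addr0.
have Gp : G p = 1%:M.
  by rewrite /G AAp mulmxBr mulmx1 mulmxBl mul1mx AAp subrr subr0 addrC subrK.
have sG : csmooth_mx I (fun y => G (chart_inv i y)).
  have s1 := csmooth_mulmx oI (A := fun=> A p) (fun a b =>
    csmooth_cst I (A p a b)) sA.
  have s2 : csmooth_mx I (fun y => 1%:M - A (chart_inv i y)).
    move=> a b; apply: (eq_csmooth oI _ (csmoothD oI (csmooth_cst I (1%:M a b))
       (csmoothM oI (csmooth_cst I (-1)) (sA a b)))) => y _.
    by rewrite [RHS]mxE [X in _ = _ + X]mxE mulN1r.
  have s3 := csmooth_mulmx oI (A := fun=> 1%:M - A p)
    (fun a b => csmooth_cst I ((1%:M - A p) a b)) s2.
  move=> a b; apply: (eq_csmooth oI _ (csmoothD oI (s1 a b) (s3 a b))) => y _.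
  by rewrite [RHS]mxE.
(* The determinant is 1 at [p], so its real part alone stays nonzero nearby, and that already makes
   [G q] invertible. *)
have cG : {for chart i p, continuous (fun y => Re (\det (G (chart_inv i y)))
  : R^o)}.
  by apply: (Ck_continuous ((csmooth_det oI sG).1 0%N)); exists p.
have nG : \forall q \near p, chart_dom i q /\ G q \in unitmx.
  have n1 : \forall y \near chart i p, Re (\det (G (chart_inv i y))) != 0.
    have : Re (\det (G (chart_inv i (chart i p)))) != 0.
      by rewrite chartK// Gp det1 /= oner_eq0.
    exact: cvgr_neq0 cG.
  have n2 : \forall q \near p, Re (\det (G (chart_inv i (chart i q)))) != 0.
    have cc : chart i @ p --> chart i p := chart_continuous pi.
    exact: cc n1.
  have n3 : \forall q \near p, chart_dom i q by exact: open_nbhs_nbhs.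
  apply: filterS2 n2 n3 => q; move=> /[swap] qi; rewrite chartK// => dG.
  split=> //; rewrite unitmxE unitfE; apply: contra dG => /eqP ->.
  by rewrite eqxx.
pose U := interior [set q | chart_dom i q /\ G q \in unitmx].
have oU : open U by exact: open_interior.
have UG q : U q -> chart_dom i q /\ G q \in unitmx by move=> /interior_subset.
(* A basis of the image at [p] is kept constant in the coordinates of chart [i] and then projected
   by [Q q]; its images under [G q] form the frame at [q]. *)
pose B := row_base (A p).
have BA : B *m A p = B.
  have /submxP[X ->] : (B <= A p)%MS by rewrite eq_row_base.
  by rewrite -mulmxA AAp.
have BG q : B *m G q = B *m A q by rewrite -BA -!mulmxA AG.
pose s a q := Q q (of_ccoord i q (row a B)).
have sE q : chart_dom i q -> \matrix_a ccoord i (s a q) = B *m A q.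
  move=> qi; apply/row_matrixP => a.
  by rewrite row_mul -(of_ccoordK (row a B) qi) -AE//; exact: rowK.
exists U, (\rank (A p)), s; split => //.
  move=> a; apply: sQ => //.
  by apply: sub_csection oi oU _ (csection_const i (row a B)) => q /UG[].
move=> q /UG[qi uG]; split.
  apply/seteqP; split=> x /=.
    move=> Qx.
    have wA : ccoord i x *m A q = ccoord i x by rewrite -AE// Qx.
    (* By the intertwining relation, pulling a vector fixed by [A q] back through [G q] gives a
       vector fixed by [A p]. *)
    have /submxP[c cE] : (ccoord i x *m invmx (G q) <= B)%MS.
      rewrite eq_row_base; apply/submxP; exists (ccoord i x *m invmx (G q)).
      apply: (can_inj (mulmxK uG)).
      by rewrite mulmxKV// -mulmxA AG -GA// mulmxA mulmxKV.
    exists (fun a => c 0 a); apply: (ccoord_inj qi);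
      rewrite ccoord_sum sE// -BG.
    rewrite -[LHS](mulmxKV uG) cE -mulmxA; congr (_ *m _).
    by apply/rowP => a; rewrite mxE.
  move=> [c ->]; apply: (ccoord_inj qi).
  by rewrite AE// ccoord_sum sE// -!mulmxA AA.
move=> c /(congr1 (@ccoord R m M i q)); rewrite ccoord_sum sE// -BG => h a.
have h0 : (\row_a c a) *m B *m G q = 0.
  by rewrite -mulmxA h (lin0 (@ccoord_linear R m M i q)).
have /(row_free_inj (row_base_free (A p))) : (\row_a c a) *m B = 0 *m B.
  by apply: (can_inj (mulmxK uG)); rewrite h0 !mul0mx.
by move=> /rowP /(_ a); rewrite !mxE.
Qed.

End Projector_bundle.

(** * The complexified metric and the eigenbundles of an endomorphism *)

Section Complexified_metric.
Variables (R : realType) (m : nat) (M : manifold R m) (p : M).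
Implicit Types (x y z : bigTc p) (a : R[i]).

Lemma metricC : commutative (@metric R m M p).
Proof. by move=> x y; rewrite /metric addrC. Qed.

Lemma metric_linear (z : bigT p) : linear (fun x : bigT p => metric x z : R^o).
Proof.
move=> a x y; rewrite /metric.
rewrite [X in X + _](_ : _ = a * x.2 z.1 + y.2 z.1) //.
have -> : z.2 (a *: x + y).1 = a * z.2 x.1 + z.2 y.1 by rewrite dual_linear.
by rewrite -[a *: _]/(a * _); ring.
Qed.

Lemma metricD (x y z : bigT p) : metric (x + y) z = metric x z + metric y z.
Proof. exact: (linD (metric_linear z)). Qed.

Lemma metricN (x z : bigT p) : metric (- x) z = - metric x z.
Proof. exact: (linN (metric_linear z)). Qed.

Lemma metricZ c (x z : bigT p) : metric (c *: x) z = c * metric x z.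
Proof. exact: (linZ (metric_linear z)). Qed.

(** Testing against (Y, 0) kills the covector part. Testing against (0, b) kills the vector part,
    since the coordinate covectors of a chart at [p] separate tangent vectors. *)
Lemma metric_nondegenerate (x : bigT p) : (forall y
  : bigT p, metric x y = 0) -> x = 0.
Proof.
move=> h; have [i pi] := chart_cover p.
have dual0 (V : lmodType R) (f : dual V)
  : f 0 = 0 by exact: (lin0 (dual_linear f)).
have h2 Y : x.2 Y = 0.
  have := h (Y, 0); rewrite /metric /= addr0 => /eqP.
  by rewrite mulf_eq0 invr_eq0 pnatr_eq0 /= => /eqP.
have h1 (b : cotangent p) : b x.1 = 0.
  have := h (0, b); rewrite /metric /= dual0 add0r => /eqP.
  by rewrite mulf_eq0 invr_eq0 pnatr_eq0 /= => /eqP.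
rewrite -(rcoordK x pi) -[RHS](rcoordK _ pi); congr of_rcoord.
rewrite [RHS](lin0 (@rcoord_linear R m M i p)).
rewrite /rcoord -row_mx0; congr row_mx; apply/rowP => k.
  have := h1 (covec i p (delta_mx 0 k)); rewrite /= /covec_fun (bigD1 k)//=.
  rewrite big1 ?addr0 => [|l /negPf lk]; last by rewrite mxE lk andbF mul0r.
  by rewrite !mxE !eqxx mul1r.
by rewrite !mxE h2.
Qed.

Local Notation g := (cform (@metric R m M p)).

Lemma cformC : commutative g.
Proof.
move=> x y; rewrite /cform !(metricC y.1) !(metricC y.2).
by congr Complex; rewrite addrC.
Qed.

Lemma cformDZ a x y z : g (a *: x + y) z = a * g x z + g y z.
Proof.
case: a => a b; rewrite /cform /= !(metricD, metricN, metricZ).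
by congr Complex; ring.
Qed.

Lemma cform_linear z : linear (fun x => g x z : R[i]^o).
Proof. by move=> a x y; exact: cformDZ. Qed.

Lemma cform0 z : g 0 z = 0.
Proof. exact: (lin0 (cform_linear z)). Qed.

Lemma cformD x y z : g (x + y) z = g x z + g y z.
Proof. exact: (linD (cform_linear z)). Qed.

Lemma cformB x y z : g (x - y) z = g x z - g y z.
Proof. exact: (linB (cform_linear z)). Qed.

Lemma cformZ a x z : g (a *: x) z = a * g x z.
Proof. exact: (linZ (cform_linear z)). Qed.

Lemma cconj_linear x y a : cconj (a *: x + y) = conjc a *: cconj x + cconj y.
Proof.
case: a => a b; rewrite [RHS]surjective_pairing /cconj.
apply: (f_equal2 pair) => /=.
  by rewrite scaleNr scalerN opprK.
by rewrite scalerN scaleNr !opprD.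
Qed.

Lemma cconjZ a x : cconj (a *: x) = conjc a *: cconj x.
Proof.
by have := cconj_linear x 0 a; rewrite addr0 => ->;
  rewrite /cconj /= oppr0 addr0.
Qed.

Lemma cconjB x y : cconj (x - y) = cconj x - cconj y.
Proof. by rewrite /cconj /=; congr pair; rewrite /= opprD. Qed.

Lemma cconjK : involutive (@cconj R (bigT p)).
Proof. by case=> x y; rewrite /cconj /= opprK. Qed.

Lemma cform_conj x y : g (cconj x) (cconj y) = conjc (g x y).
Proof.
have metricNr (u v : bigT p) : metric u (- v) = - metric u v.
  by rewrite !(metricC u) metricN.
rewrite /cform /= !(metricN, metricNr).
by congr Complex; rewrite ?opprK// opprD.
Qed.

Lemma cform_nondegenerate x : (forall y, g x y = 0) -> x = 0.
Proof.
move=> h.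
(* Real test vectors suffice: against them the real and imaginary parts of the form are the metric
   applied to the two parts of [x]. *)
have h0 (y : bigT p) : metric x.1 y = 0 /\ metric x.2 y = 0.
  have m0 (u : bigT p) : metric u 0 = 0.
    by rewrite metricC -(scale0r 0) metricZ mul0r.
  by have := h (y, 0); rewrite /cform /= !m0 subr0 add0r => -[-> ->].
case: x h h0 => x1 x2 _ h0; congr pair; apply: metric_nondegenerate => y.
  exact: (h0 y).1.
exact: (h0 y).2.
Qed.

Lemma complexify_linear (f : bigT p -> bigT p) : linear f ->
  linear (complexify f).
Proof.
move=> lf [a b] x y; rewrite [RHS]surjective_pairing /complexify.
apply: (f_equal2 pair) => /=.
  by rewrite !(linD lf) (linN lf) !(linZ lf).
by rewrite !(linD lf) !(linZ lf).
Qed.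

Lemma complexify_conj (f : bigT p -> bigT p) x : linear f ->
  complexify f (cconj x) = cconj (complexify f x).
Proof. by move=> lf; rewrite /complexify /cconj /= (linN lf). Qed.

Lemma cform_complexify (f : bigT p -> bigT p) x y :
  (forall u v, metric (f u) v + metric u (f v) = 0) ->
  g (complexify f x) y + g x (complexify f y) = 0.
Proof.
move=> sk; have sk' u v : metric (f u) v = - metric u (f v).
  by apply/eqP; rewrite -addr_eq0 sk.
by rewrite /cform /= !sk'; congr Complex; ring.
Qed.

End Complexified_metric.

(** * Spectral projectors by interpolation *)

Section Spectral_projector.
Variables (R : realType) (V : lmodType R[i]) (F : V -> V).
Hypotheses (lF : linear F) (F3 : forall x, F (F (F x)) + F x = 0).
Variable z : R[i].
Hypothesis z2 : z * z = -1.

(** The Lagrange interpolation polynomial on the roots z, -z, 0 of t^3 + t, with value 1 at z and 0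
    at the two others, evaluated at [F]. *)
Definition spectral_proj (x : V) : V := - 2^-1 *: (F (F x) + z *: F x).

Lemma spectral_proj_linear : linear spectral_proj.
Proof.
move=> a x y; rewrite /spectral_proj !(linD lF, linZ lF).
rewrite [in RHS]scalerA [a * _]mulrC -scalerA -scalerDr; congr (_ *: _).
by rewrite !scalerDr addrACA !scalerA [z * a]mulrC.
Qed.

Lemma F_spectral_proj x : F (spectral_proj x) = z *: spectral_proj x.
Proof.
have F3' : F (F (F x)) = - F x by apply/eqP; rewrite -addr_eq0 F3.
rewrite /spectral_proj (linZ lF) (linD lF) (linZ lF) F3'.
rewrite scalerA [z * _]mulrC -scalerA; congr (_ *: _).
by rewrite scalerDr scalerA z2 scaleN1r addrC.
Qed.

(** Presents the eigenspace as a fixed-point set, the shape required by [projector_subbundle]. *)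
Lemma spectral_projP x : spectral_proj x = x <-> F x = z *: x.
Proof.
split=> [<-|Fx]; first exact: F_spectral_proj.
rewrite /spectral_proj Fx (linZ lF) Fx scalerA z2 scaleN1r -opprD -mulr2n.
by rewrite scaleNr scalerN opprK -(scaler_nat 2 x) scalerA mulVf ?scale1r//
  pnatr_eq0.
Qed.

End Spectral_projector.

Section Spectral_decomposition.
Variables (R : realType) (V : lmodType R[i]) (F : V -> V).

Lemma mulii : 'i%C * 'i%C = -1 :> R[i].
Proof. by rewrite -expr2 sqr_i. Qed.

Lemma mulNii : - 'i%C * - 'i%C = -1 :> R[i].
Proof. by rewrite mulrNN mulii. Qed.

(** The interpolation polynomials for i, -i and 0, the last being 1 + t^2, sum to 1. *)
Lemma spectral_decomp x :
  x = spectral_proj F 'i%C x + spectral_proj F (- 'i%C) x + (x + F (F x)).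
Proof.
rewrite /spectral_proj -scalerDr addrACA -scalerDl subrr scale0r addr0 -mulr2n.
rewrite -(scaler_nat 2 (F _)) scalerA mulNr mulVf ?pnatr_eq0// scaleN1r.
by rewrite addrCA addNr addr0.
Qed.

End Spectral_decomposition.

(** As the metric is real, the conjugate of E' is the orthogonal of conj E. *)
Lemma conjugate_orthogonal (R : realType) (m : nat) (M : manifold R m)
    (E : forall p : M, set (bigTc p)) p (x : bigTc p) :
  conjugate (Defs.orthogonal E) p x <->
  forall y, E p y -> cform (@metric R m M p) x (cconj y) = 0.
Proof.
split=> [[z hz <-] y Ey|h]; first by rewrite cform_conj hz// conjc0.
exists (cconj x); last by rewrite cconjK.
by move=> y Ey; rewrite -[y]cconjK cform_conj h// conjc0.
Qed.

(** * From an endomorphism to a generalized F-structure *)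

Section F_endomorphism_structure.
Variables (R : realType) (m : nat) (M : manifold R m).
Variable Phi : forall p : M, bigT p -> bigT p.
Hypothesis hPhi : F_endomorphism Phi.

Local Notation F p := (complexify (@Phi p)).
Local Notation g := (cform (@metric R m M _)).

Definition eigenspaces (z : R[i]) (p : M) : set (bigTc p) :=
  [set x | F p x = z *: x].

Arguments eigenspaces : clear implicits.

Let lPhi p : linear (@Phi p). Proof. by case: hPhi => -[]. Qed.
Let lF p : linear (F p). Proof. exact: complexify_linear. Qed.

Let F3 p (x : bigTc p) : F p (F p (F p x)) + F p x = 0.
Proof. by case: hPhi => _ h _; rewrite /complexify; congr pair => /=;
  exact: h. Qed.

Let skew p (x y : bigTc p) : g (F p x) y = - g x (F p y).
Proof.
apply/eqP; rewrite -addr_eq0 cform_complexify// => u v.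
by case: hPhi => _ _; apply.
Qed.

Lemma smooth_complexify U (s : forall p, bigTc p) : open U ->
  smooth_csection U s -> smooth_csection U (fun p => F p (s p)).
Proof.
by case: hPhi => -[_ sm] _ _ oU [s1 s2]; split; apply: sm.
Qed.

Lemma subbundle_eigenspaces (z : R[i]) : z * z = -1 ->
  subbundle (eigenspaces z).
Proof.
move=> z2; have -> : eigenspaces z =
    fun p => [set x | spectral_proj (F p) z x = x].
  apply: functional_extensionality_dep => p; apply/seteqP.
  by split=> x /= /(spectral_projP (@lF p) (@F3 p) z2).
apply: projector_subbundle => [p|p x|U s oU hs].
- exact: (spectral_proj_linear (@lF p)).
- by apply/(spectral_projP (@lF p) (@F3 p) z2);
  exact: (F_spectral_proj (@lF p) (@F3 p) z2).
- have h1 := smooth_complexify oU hs.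
  apply: csectionZ => //; first exact: cfun_smooth_cst.
  apply: csectionD => //; first exact: smooth_complexify.
  by apply: csectionZ => //; exact: cfun_smooth_cst.
Qed.

Lemma subbundle_kernel : subbundle (eigenspaces 0).
Proof.
have F3' p (x : bigTc p) : F p (F p (F p x)) = - F p x.
  by apply/eqP; rewrite -addr_eq0 F3.
have -> : eigenspaces 0 = fun p => [set x | x + F p (F p x) = x].
  apply: functional_extensionality_dep => p.
  apply/seteqP; split=> x; rewrite /eigenspaces /= scale0r.
    by move=> ->; rewrite (lin0 (@lF p)) addr0.
  (* F maps x + F(F x) to 0 for every x, so a fixed point lies in the kernel. *)
  by move=> /(congr1 (F p)); rewrite (linD (@lF p)) F3' subrr.
apply: projector_subbundle => [p a x y|p x|U s oU hs].
- by rewrite !(linD (@lF p), linZ (@lF p)) scalerDr addrACA.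
- by rewrite !(linD (@lF p)) F3' subrr addr0.
- by apply: csectionD => //; do 2!apply: smooth_complexify => //.
Qed.

(** The adjoint of F is -F, so a polynomial in t turns into the same polynomial in -t; here this
    amounts to replacing z by -z. *)
Lemma spectral_proj_adjoint p z (x y : bigTc p) :
  g (spectral_proj (F p) z x) y = g x (spectral_proj (F p) (- z) y).
Proof.
rewrite /spectral_proj [in RHS]cformC.
rewrite !(cformZ, cformD) !(cformC _ x) !skew opprK.
by congr (_ * (_ + _)); rewrite mulrN mulNr.
Qed.

Lemma conjugate_eigenspaces : conjugate (eigenspaces 'i%C) = eigenspaces (-
  'i%C).
Proof.
have conj_i : conjc (- 'i%C : R[i]) = 'i%C by congr Complex;
  rewrite ?oppr0 ?opprK.
apply: functional_extensionality_dep => p; apply/seteqP; split=> x.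
  move=> [y Fy <-]; have {}Fy : F p y = 'i%C *: y by [].
  rewrite /eigenspaces /= complexify_conj// Fy cconjZ.
  by congr (_ *: _); congr Complex; rewrite oppr0.
rewrite /eigenspaces /= => Fx.
have Fcx : F p (cconj x) = 'i%C *: cconj x.
  by rewrite complexify_conj// Fx cconjZ conj_i.
by exists (cconj x) => //; rewrite cconjK.
Qed.

(** Skewness gives z g(x, y) = - z g(x, y). *)
Lemma eigenspaces_isotropic p (x y : bigTc p) z : z != 0 ->
  eigenspaces z p x -> eigenspaces z p y -> g x y = 0.
Proof.
move=> z0 Fx Fy; have := skew x y.
have {}Fx : F p x = z *: x by []; have {}Fy : F p y = z *: y by [].
rewrite Fx Fy (cformC x) !cformZ (cformC y) => /eqP.
by rewrite -addr_eq0 -mulr2n mulrn_eq0 /= mulf_eq0 (negPf z0) => /eqP.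
Qed.

(** The eigenspace is the image of the projector for z, so by nondegeneracy its orthogonal is the
    kernel of the adjoint, the projector for -z. *)
Lemma orthogonal_eigenspaces p (z : R[i]) (x : bigTc p) : z * z = -1 ->
  Defs.orthogonal (eigenspaces z) p x <-> spectral_proj (F p) (- z) x = 0.
Proof.
move=> z2; split=> [h|h y Fy].
  apply: cform_nondegenerate => y; rewrite spectral_proj_adjoint opprK.
  by apply: h; exact: (F_spectral_proj (@lF p) (@F3 p) z2).
have /(spectral_projP (@lF p) (@F3 p) z2) <- := Fy.
rewrite -[z]opprK -spectral_proj_adjoint h.
exact: cform0.
Qed.

Lemma eigenspaces_zero :
  eigenspaces 0 = fun p => Defs.orthogonal (eigenspaces 'i%C) p `&`
                           conjugate (Defs.orthogonal (eigenspaces 'i%C)) p.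
Proof.
apply: functional_extensionality_dep => p.
have conjE (x : bigTc p) : conjugate (Defs.orthogonal (eigenspaces 'i%C)) p x
  <->
    spectral_proj (F p) 'i%C x = 0.
  (* The conjugate of E' is the orthogonal of the eigenbundle for -i, so the previous description is
     used with z = -i. *)
  rewrite -{2}['i%C]opprK -(orthogonal_eigenspaces _ (mulNii R)).
  rewrite conjugate_orthogonal -conjugate_eigenspaces;
    split=> [h _ [y Ey <-]|h y Ey].
    exact: h.
  by apply: h; exists y.
apply/seteqP; split=> x.
  rewrite /eigenspaces /= scale0r => Fx.
  have P0 z : spectral_proj (F p) z x = 0.
    by rewrite /spectral_proj Fx (lin0 (@lF p)) scaler0 addr0 scaler0.
  split; first by apply/(orthogonal_eigenspaces _ (mulii R)).
  by apply/conjE.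
move=> [/(orthogonal_eigenspaces _ (mulii R)) Px /conjE Px'].
(* With both projections zero, the decomposition reads x = x + F(F x); then F(F x) = 0, and the
   cubic relation leaves F x = 0. *)
have := spectral_decomp (F p) x; rewrite Px Px' !add0r => /eqP.
rewrite -subr_eq0 opprD addNKr oppr_eq0 => /eqP FFx.
rewrite /eigenspaces /= scale0r; have := @F3 p x.
by rewrite FFx (lin0 (@lF p)) add0r.
Qed.

Lemma F_correspondence_eigenspaces : F_correspondence (eigenspaces 'i%C) Phi.
Proof.
rewrite /F_correspondence conjugate_eigenspaces -eigenspaces_zero; split;
  split=> //.
- exact: subbundle_eigenspaces (mulii R).
- exact: subbundle_eigenspaces (mulNii R).
- exact: subbundle_kernel.
Qed.

Lemma generalized_F_structure_eigenspaces :
  generalized_F_structure (eigenspaces 'i%C).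
Proof.
have i0 : 'i%C != 0 :> R[i] by rewrite eq_complex /= oner_eq0 andbF.
split; first exact: subbundle_eigenspaces (mulii R).
  by move=> p x Ex y; exact: eigenspaces_isotropic i0 Ex.
move=> p; apply/seteqP; split=> [x|_ ->]; last first.
  split; first by rewrite /eigenspaces /= (lin0 (@lF p)) scaler0.
  by apply/conjugate_orthogonal => y _; exact: cform0.
move=> [Ex /conjugate_orthogonal hx] /=.
(* Once [x] is written as its own projection, pairing it with any [y] amounts to pairing it with the
   projection of [y] to conj E, where the pairing vanishes. *)
have /(spectral_projP (@lF p) (@F3 p) (mulii R)) <- := Ex.
apply: cform_nondegenerate => y; rewrite spectral_proj_adjoint.
have : eigenspaces (- 'i%C) p (spectral_proj (F p) (- 'i%C) y).
  exact: (F_spectral_proj (@lF p) (@F3 p) (mulNii R)).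
by rewrite -conjugate_eigenspaces => -[z Ez <-]; exact: hx.
Qed.

End F_endomorphism_structure.

(** * From a generalized F-structure to an endomorphism *)

Section Isotropic_projection.
Variables (R : realType) (m : nat) (M : manifold R m) (p : M).
Local Notation g := (cform (@metric R m M p)).

Variables (E : set (bigTc p)) (P : bigTc p -> bigTc p).
Hypothesis E_lin : forall a x y, E x -> E y -> E (a *: x + y).
Hypothesis E_iso : forall x y, E x -> E y -> g x y = 0.
Hypothesis E_nd : forall x, E x -> (forall y, E y -> g x (cconj y) = 0) ->
  x = 0.
Hypothesis P_in : forall x, E (P x).
Hypothesis P_perp : forall x y, E y -> g (x - P x) (cconj y) = 0.

Let E0 : E 0.
Proof.
by have := E_lin (-1) (P_in 0) (P_in 0); rewrite scaleN1r addNr.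
Qed.

(** The difference of two candidates lies in E and is orthogonal to conj E, hence is 0. Linearity
    and the values of P below are all obtained by exhibiting a candidate. *)
Lemma proj_unique x y :
  E y -> (forall z, E z -> g (x - y) (cconj z) = 0) -> P x = y.
Proof.
move=> Ey hy; apply/eqP; rewrite -subr_eq0; apply/eqP; apply: E_nd.
  by rewrite addrC -scaleN1r; exact: E_lin.
move=> z Ez; have -> : P x - y = (x - y) - (x - P x) by rewrite opprB
  [RHS]addrC subrKA.
by rewrite cformB hy// P_perp// subrr.
Qed.

Lemma proj_id x : E x -> P x = x.
Proof. by move=> Ex; apply: proj_unique => // z _; rewrite subrr cform0. Qed.

Lemma proj_conj x : E x -> P (cconj x) = 0.
Proof.
move=> Ex; apply: proj_unique => // z Ez.
by rewrite subr0 cform_conj E_iso// conjc0.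
Qed.

Lemma proj_linear : linear P.
Proof.
move=> a x y; apply: proj_unique; first exact: E_lin.
move=> z Ez; have -> : a *: x + y - (a *: P x + P y) = a *: (x - P x)
  + (y - P y).
  by rewrite opprD addrACA scalerBr.
by rewrite cformDZ !P_perp// mulr0 addr0.
Qed.

(** The projector onto conj E along E'; the two conjugations make it complex linear. *)
Definition conj_proj x := cconj (P (cconj x)).

Lemma conj_proj_linear : linear conj_proj.
Proof.
move=> a x y; rewrite /conj_proj cconj_linear proj_linear cconj_linear.
by rewrite conjcK.
Qed.

Lemma proj_conj_proj x : P (conj_proj x) = 0.
Proof. exact: proj_conj. Qed.

Lemma conj_proj_proj x : conj_proj (P x) = 0.
Proof. by rewrite /conj_proj proj_conj// /cconj /= oppr0. Qed.

Lemma conj_projK x : conj_proj (conj_proj x) = conj_proj x.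
Proof. by rewrite /conj_proj cconjK proj_id. Qed.

(** Both sides equal g(P x, conj_proj y): x - P x is orthogonal to conj E, and y - conj_proj y is
    orthogonal to E. *)
Lemma proj_adjoint x y : g (P x) y = g x (conj_proj y).
Proof.
have e1 : g x (conj_proj y) = g (P x) (conj_proj y).
  have := P_perp x (P_in (cconj y)); rewrite cformB => /eqP.
  by rewrite subr_eq0 => /eqP.
rewrite e1 !(cformC (P x)).
have := P_perp (cconj y) (P_in x).
rewrite -[X in X = 0]conjcK -cform_conj cconjK cconjB cconjK =>
  /(congr1 (@conjc R)).
rewrite conjcK conjc0 cformB => /eqP.
by rewrite subr_eq0 => /eqP.
Qed.

Definition iso_endo x := 'i%C *: (P x - conj_proj x).

Lemma iso_endo_linear : linear iso_endo.
Proof.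
move=> a x y; rewrite /iso_endo proj_linear conj_proj_linear.
rewrite opprD addrACA -scalerBr scalerDr; congr (_ + _).
by rewrite !scalerA mulrC.
Qed.

Lemma iso_endo_conj x : iso_endo (cconj x) = cconj (iso_endo x).
Proof.
rewrite /iso_endo cconjZ cconjB /conj_proj !cconjK.
have -> : conjc 'i%C = - 'i%C :> R[i] by congr Complex; rewrite oppr0.
by rewrite scaleNr -scalerN opprB.
Qed.

Lemma proj_iso_endo x : P (iso_endo x) = 'i%C *: P x.
Proof.
rewrite /iso_endo (linZ proj_linear) (linB proj_linear) proj_conj_proj subr0.
by rewrite (proj_id (P_in x)).
Qed.

Lemma conj_proj_iso_endo x : conj_proj (iso_endo x) = - ('i%C *: conj_proj x).
Proof.
rewrite /iso_endo (linZ conj_proj_linear) (linB conj_proj_linear).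
by rewrite conj_proj_proj sub0r scalerN conj_projK.
Qed.

Lemma iso_endo3 x : iso_endo (iso_endo (iso_endo x)) + iso_endo x = 0.
Proof.
have u y : iso_endo y = 'i%C *: (P y - conj_proj y) by [].
rewrite (u (iso_endo (iso_endo x))) !(proj_iso_endo, conj_proj_iso_endo) (u x).
rewrite opprK scalerN (scalerA _ _ (P x)) (scalerA _ _ (conj_proj x)) mulii.
by rewrite !scaleN1r opprK -scalerDr addrACA addNr add0r subrr scaler0.
Qed.

Lemma iso_endo_skew x y : g (iso_endo x) y + g x (iso_endo y) = 0.
Proof.
rewrite /iso_endo (cformC x) !cformZ !cformB -mulrDr !(cformC _ x).
have -> : g (conj_proj x) y = g x (P y).
  by rewrite cformC -proj_adjoint cformC.
by rewrite proj_adjoint -opprB addNr mulr0.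
Qed.

Lemma iso_endo_eigen x : iso_endo x = 'i%C *: x <-> E x.
Proof.
have i0 : 'i%C != 0 :> R[i] by rewrite eq_complex /= oner_eq0 andbF.
split=> [|Ex]; last first.
  by rewrite /iso_endo proj_id// -[x in conj_proj x](proj_id Ex) conj_proj_proj
    subr0.
(* Applying [conj_proj] to the eigenvalue equation gives i c = - i c for c = conj_proj x, so c = 0
   and the equation reduces to P x = x. *)
move=> e; have := conj_proj_iso_endo x;
  rewrite e (linZ conj_proj_linear) => /eqP.
rewrite -addr_eq0 -scalerDr scaler_eq0 (negPf i0) /= -mulr2n => /eqP h.
have cx : conj_proj x = 0.
  by apply/eqP; move: h => /eqP; rewrite -scaler_nat scaler_eq0 pnatr_eq0.
move: e; rewrite /iso_endo cx subr0 => /(scalerI i0) <-.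
exact: P_in.
Qed.

End Isotropic_projection.

Lemma complexify_cube_eq0 (R : realType) (V : lmodType R) (f : V -> V) :
  (forall z, complexify f (complexify f (complexify f z))
    + complexify f z = 0) ->
  forall x, f (f (f x)) + f x = 0.
Proof. by move=> h x; exact: (congr1 fst (h (x, 0))). Qed.

(** * The projection in a frame of E *)

Section Frame_projection.
Variables (R : realType) (m : nat) (M : manifold R m) (p : M).
Local Notation g := (cform (@metric R m M p)).
Variables (k : nat) (e : 'I_k -> bigTc p).

Lemma cform_sum (c : 'I_k -> R[i]) z :
  g (\sum_a c a *: e a) z = \sum_a c a * g (e a) z.
Proof. exact: (lin_sum (cform_linear z)). Qed.

Definition gram : 'M[R[i]]_k := \matrix_(a, b) g (e a) (cconj (e b)).

Definition frame_coef (x : bigTc p) : 'rV[R[i]]_k :=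
  (\row_b g x (cconj (e b))) *m invmx gram.

Definition frame_proj x := \sum_a frame_coef x 0 a *: e a.

Variable E : set (bigTc p).
Hypothesis E_span : E = [set x | exists c : 'I_k ->
  R[i], x = \sum_(a < k) c a *: e a].
Hypothesis E_free : forall c : 'I_k -> R[i],
  \sum_(a < k) c a *: e a = 0 -> forall a, c a = 0.
Hypothesis E_nd : forall x, E x -> (forall y, E y -> g x (cconj y) = 0) ->
  x = 0.

Lemma perp_span x : (forall b, g x (cconj (e b)) = 0) ->
  forall y, E y -> g x (cconj y) = 0.
Proof.
move=> h y; rewrite E_span => -[c ->].
rewrite -[x]cconjK cform_conj cformC cform_sum big1 ?conjc0// => a _.
by rewrite -[e a]cconjK cform_conj cformC h conjc0 mulr0.
Qed.

(** A row killed by the Gram matrix is the coefficient row of a vector of E orthogonal to conj E.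
    That vector is 0, and freeness of the frame makes the row 0. *)
Lemma gram_unit : gram \in unitmx.
Proof.
rewrite -row_free_unit; apply: inj_row_free => c cH.
apply/rowP => a; rewrite mxE; apply: (E_free (c := fun a => c 0 a)).
apply: E_nd; first by rewrite E_span; exists (fun a => c 0 a).
apply: perp_span => b; rewrite cform_sum.
have /rowP /(_ b) := cH; rewrite !mxE => {2}<-.
by apply: eq_bigr => l _; rewrite mxE.
Qed.

Lemma frame_proj_in x : E (frame_proj x).
Proof. by rewrite E_span; exists (fun a => frame_coef x 0 a). Qed.

Lemma frame_proj_perp x y : E y -> g (x - frame_proj x) (cconj y) = 0.
Proof.
apply: perp_span => b; rewrite cformB cform_sum.
have : frame_coef x *m gram = \row_b g x (cconj (e b)).
  by rewrite mulmxKV// gram_unit.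
move=> /rowP /(_ b); rewrite mxE [RHS]mxE => <-; apply/eqP; rewrite subr_eq0.
by apply/eqP/eq_bigr => a _; rewrite [gram _ _]mxE.
Qed.

End Frame_projection.

(** * The global projection and its real endomorphism *)

Section F_structure_endomorphism.
Variables (R : realType) (m : nat) (M : manifold R m).
Variable E : forall p : M, set (bigTc p).
Hypothesis hE : generalized_F_structure E.
Local Notation g := (cform (@metric R m M _)).

Let E_lin p a (x y : bigTc p) : E x -> E y -> E (a *: x + y).
Proof.
case: hE => sE _ _; have [U [k [s [_ Up _ h]]]] := sE p.
have [-> _] := h p Up; move=> [c ->] [d ->]; exists (fun b => a * c b + d b).
rewrite scaler_sumr -big_split; apply: eq_bigr => b _.
by rewrite scalerDl scalerA.
Qed.

Let E_iso p (x y : bigTc p) : E x -> E y -> g x y = 0.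
Proof. by case: hE => _ h _ /h; apply. Qed.

Let E_nd p (x : bigTc p) :
  E x -> (forall y, E y -> g x (cconj y) = 0) -> x = 0.
Proof.
case: hE => _ _ h Ex /conjugate_orthogonal hx.
by have : [set 0] x by rewrite -(h p).
Qed.

(** Chosen by its characterization, so that no local frame enters the definition. The default 0 is
    harmless: [F_proj_spec] shows that a solution always exists. *)
Definition F_proj p (x : bigTc p) : bigTc p :=
  xget 0 [set y | E y /\ forall z, E z -> g (x - y) (cconj z) = 0].

Let F_proj_spec p (x : bigTc p) :
  E (F_proj x) /\ forall z, E z -> g (x - F_proj x) (cconj z) = 0.
Proof.
case: hE => sE _ _; have [U [k [s [_ Up _ h]]]] := sE p.
have [Es Ef] := h p Up.
apply: (@xgetPex _ 0 [set y | E y /\ forall z, E z -> g (x - y) (cconj z) = 0]).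
exists (frame_proj (s^~ p) x); split; first exact: frame_proj_in.
by move=> z; apply: frame_proj_perp => //; exact: E_nd.
Qed.

Let P_in p (x : bigTc p) : E (F_proj x). Proof. exact: (F_proj_spec x).1. Qed.

Let P_perp p (x y : bigTc p) : E y -> g (x - F_proj x) (cconj y) = 0.
Proof. exact: (F_proj_spec x).2. Qed.

Lemma smooth_frame_proj U k (s : 'I_k -> forall p : M, bigTc p) t : open U ->
  (forall a, smooth_csection U (s a)) -> smooth_csection U t ->
  (forall q, U q -> gram (s^~ q) \in unitmx) ->
  smooth_csection U (fun q => frame_proj (s^~ q) (t q)).
Proof.
move=> oU hs ht uG; apply: csection_sum => // a i.
have oI : open (chart_img i U) by exact: open_chart_img.
have sc b := csection_conj oU (hs b).
pose r q : 'rV[R[i]]_k := \row_b g (t q) (cconj (s b q)).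
have h1 : csmooth_mx (chart_img i U) (fun y => r (chart_inv i y)).
  move=> z b; apply: (eq_csmooth oI _ (cfun_smooth_form oU ht (sc b) i)) => y _.
  by rewrite mxE.
have h2 : csmooth_mx (chart_img i U) (fun y => gram (s^~ (chart_inv i y))).
  move=> b c; apply: (eq_csmooth oI _ (cfun_smooth_form oU (hs b) (sc c) i)) =>
    y _.
  by rewrite mxE.
have h3 := csmooth_invmx oI (fun y Iy => uG _ (chart_imgK Iy)) h2.
exact: (csmooth_mulmx oI h1 h3).
Qed.

Lemma smooth_F_proj U t : open U -> smooth_csection U t ->
  smooth_csection U (fun q => F_proj (t q)).
Proof.
move=> oU ht; apply: csection_local => // p Up.
case: hE => sE _ _; have [U' [k [s [oU' U'p hs h]]]] := sE p.
have oUU' : open (U `&` U') by exact: openI.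
exists (U `&` U'); split=> //.
have IU : U `&` U' `<=` U by exact: subIsetl.
have IU' : U `&` U' `<=` U' by exact: subIsetr.
have fr : smooth_csection (U `&` U') (fun q => frame_proj (s^~ q) (t q)).
  apply: smooth_frame_proj => //.
  - by move=> a; exact: sub_csection oU' oUU' IU' (hs a).
  - exact: sub_csection oU oUU' IU ht.
  - move=> q [_ U'q]; have [Es Ef] := h q U'q.
    exact: gram_unit Es Ef (@E_nd q).
apply: (eq_csection oUU' _ fr) => q [_ U'q]; have [Es Ef] := h q U'q.
(* Uniqueness identifies the chosen projection with the smooth formula in the frame. *)
apply/esym/(proj_unique (@E_lin q) (@E_nd q) (@P_in q) (@P_perp q)).
  exact: frame_proj_in.
by move=> z; exact: (frame_proj_perp Es Ef (@E_nd q)).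
Qed.

Local Notation Psi p := (iso_endo (@F_proj p)).

Definition F_endo p (x : bigT p) : bigT p := (Psi p (x, 0)).1.

Let Psi_linear p : linear (Psi p).
Proof. exact: (iso_endo_linear (@E_lin p) (@E_nd p) (@P_in p) (@P_perp p)). Qed.

(** [Psi] commutes with conjugation, so the imaginary part of its value at a real vector is its own
    opposite and vanishes. Complex linearity extends the equality from real vectors to x + i y. *)
Lemma complexify_F_endo p : complexify (@F_endo p) = Psi p.
Proof.
have real x : Psi p (x, 0) = (F_endo x, 0).
  have c : cconj (x, 0) = (x, 0) :> bigTc p by rewrite /cconj /= oppr0.
  have e : (Psi p (x, 0)).2 = - (Psi p (x, 0)).2.
    by rewrite -[in LHS]c iso_endo_conj.
  rewrite [LHS]surjective_pairing; congr pair; apply/eqP.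
  move/eqP: e; rewrite -addr_eq0 -mulr2n -scaler_nat scaler_eq0 pnatr_eq0.
  exact.
have split_i (x y : bigT p) : (x, y) = ((x, 0) : bigTc p) + 'i%C *: ((y, 0)
  : bigTc p).
  rewrite [RHS]surjective_pairing; apply: (f_equal2 pair) => /=.
    by rewrite scaler0 subr0 scale0r addr0.
  by rewrite scaler0 scale1r !add0r.
apply/funext => -[x y]; rewrite [in RHS]split_i (linD (@Psi_linear p)).
by rewrite (linZ (@Psi_linear p)) !real -split_i.
Qed.

Lemma F_endo_linear p : linear (@F_endo p).
Proof.
move=> a x y.
have e : (a *: x + y, 0) = (real_complex R a) *: ((x, 0) : bigTc p) + ((y, 0)
  : bigTc p).
  rewrite [RHS]surjective_pairing; apply: (f_equal2 pair) => /=.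
    by rewrite scale0r subr0.
  by rewrite scaler0 scale0r !addr0.
rewrite /F_endo e (@Psi_linear p).
by move: (Psi p (x, 0)) (Psi p (y, 0)) => u v; rewrite /= scale0r subr0.
Qed.

Lemma smooth_F_endo U s : open U -> smooth_section U s ->
  smooth_section U (fun p => F_endo (s p)).
Proof.
move=> oU hs.
have s0 : @smooth_section R m M U (fun=> 0).
  move=> i; split=> n; first exact: Ck_cst.
  have -> : (fun y => cotangent_comp i ((0 : bigT (chart_inv i y)).2)) = cst 0.
    by apply/funext => y; apply/rowP => k; rewrite !mxE.
  exact: Ck_cst.
have hs0 : @smooth_csection R m M U (fun p => (s p, 0)) by split.
suff : smooth_csection U (fun p => Psi p (s p, 0)) by case.
apply: csectionZ => //; first exact: cfun_smooth_cst.
apply: csectionD => //; first exact: smooth_F_proj.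
have h : smooth_csection U (fun p => -1 *: conj_proj (@F_proj p) (s p, 0)).
  apply: csectionZ => //; first exact: cfun_smooth_cst.
  by apply: csection_conj => //; apply: smooth_F_proj => //;
    exact: csection_conj.
by apply: (eq_csection oU _ h) => q _; rewrite scaleN1r.
Qed.

Lemma F_endo3 p (x : bigT p) : F_endo (F_endo (F_endo x)) + F_endo x = 0.
Proof.
move: x; apply: complexify_cube_eq0 => z; rewrite complexify_F_endo.
exact: (iso_endo3 (@E_lin p) (@E_iso p) (@E_nd p) (@P_in p) (@P_perp p)).
Qed.

Lemma F_endo_skew p (x y : bigT p) : metric (F_endo x) y
  + metric x (F_endo y) = 0.
Proof.
have := iso_endo_skew (@P_in p) (@P_perp p) (x, 0) (y, 0).
have m0 (u : bigT p) : metric 0 u = 0 by rewrite -(scale0r 0) metricZ mul0r.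
rewrite -complexify_F_endo; move: (@F_endo p) => f.
move=> /(congr1 (@complex.Re R)) /=.
by rewrite (metricC _ 0) !m0 !subr0.
Qed.

Lemma F_endo_endomorphism : F_endomorphism F_endo.
Proof.
split; [split|exact: F_endo3|exact: F_endo_skew]; first exact: F_endo_linear.
by move=> U s; exact: smooth_F_endo.
Qed.

Lemma eigenspaces_F_endo : eigenspaces F_endo 'i%C = E.
Proof.
apply: functional_extensionality_dep => p; apply/seteqP.
have h x := iso_endo_eigen (@E_lin p) (@E_iso p) (@E_nd p) (@P_in p) (@P_perp
  p) x.
by split=> x; rewrite /eigenspaces /= complexify_F_endo => /h.
Qed.

End F_structure_endomorphism.

(** The spectral projectors of Phi split every vector into eigenvectors of Phi. Each piece lies in a
    bundle that is also the eigenbundle of Psi for the same eigenvalue, so the two maps agree on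
    it. *)
Lemma F_correspondence_unique (R : realType) (m : nat) (M : manifold R m)
    (E : forall p : M, set (bigTc p)) (Phi Psi : forall p : M, bigT p ->
      bigT p) :
  F_endomorphism Phi -> F_endomorphism Psi ->
  F_correspondence E Phi -> F_correspondence E Psi -> Phi = Psi.
Proof.
move=> [[lPhi _] Phi3 _] [[lPsi _] _ _] [[_ E1] [_ E2] [_ E0]] [[_ E1'] [_ E2']
  [_ E0']].
apply: functional_extensionality_dep => p; apply/funext => x.
pose F := complexify (@Phi p); pose G := complexify (@Psi p).
have lF : linear F by exact: complexify_linear.
have lG : linear G by exact: complexify_linear.
have F3 y : F (F (F y)) + F y = 0.
  by rewrite /F /complexify; congr pair => /=; exact: Phi3.
have FG z (A : set (bigTc p)) : A = [set y | F y = z *: y] ->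
    A = [set y | G y = z *: y] -> forall y, F y = z *: y -> G y = F y.
  move=> AF AG y Fy; rewrite Fy.
  by have : [set y | F y = z *: y] y by []; rewrite -AF AG.
suff : G (x, 0) = F (x, 0) by move=> /(congr1 fst).
rewrite (spectral_decomp F (x, 0)) !(linD lF, linD lG); congr (_ + _ + _).
- exact: FG (E1 p) (E1' p) _ (F_spectral_proj lF F3 (mulii R) _).
- exact: FG (E2 p) (E2' p) _ (F_spectral_proj lF F3 (mulNii R) _).
- rewrite -!linD //; apply: FG (E0 p) (E0' p) _ _.
  by rewrite (linD lF) addrC F3 scale0r.
Qed.

Theorem proposition2p1 (R : realType) (m : nat) (M : manifold R m) :
  (forall E : forall p : M, set (bigTc p), generalized_F_structure E ->
     exists! Phi : forall p : M, bigT p -> bigT p,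
       F_endomorphism Phi /\ F_correspondence E Phi) /\
  (forall Phi : forall p : M, bigT p -> bigT p, F_endomorphism Phi ->
     exists! E : forall p : M, set (bigTc p),
       generalized_F_structure E /\ F_correspondence E Phi).
Proof.
split=> [E hE|Phi hPhi].
  have hEnd := F_endo_endomorphism hE.
  have hC : F_correspondence E (F_endo E).
    (* With [E] replaced by the i-eigenbundle of [F_endo E], the frames of conj E and S_c come from
       the spectral projectors. *)
    rewrite -{1}(eigenspaces_F_endo hE); exact: F_correspondence_eigenspaces.
  exists (F_endo E); split=> // Phi [hPhi hC'].
  exact: F_correspondence_unique hEnd hPhi hC hC'.
exists (eigenspaces Phi 'i%C); split.
  split; first exact: generalized_F_structure_eigenspaces.
  exact: F_correspondence_eigenspaces.
(* The first clause of the correspondence alone determines [E], as the i-eigenspace in each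
   fibre. *)
move=> E [_ [[_ hE] _ _]]; apply: functional_extensionality_dep => p.
by rewrite hE.
Qed.
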